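(* Let $\mathcal C$ be a braided monoidal category, let $\mathsf C$ be the Catalan simplicial set, and let $\mathsf M$ be the simplicial set associated to $\mathcal C$ (both described in the context). There is a bijection between simplicial maps $\mathsf C\to\mathsf M$ and regular multiplier bimonoids in $\mathcal C$.
   Context: **Notation.** $\mathcal C$ is a braided monoidal category, not assumed strict, but associativity and unit isomorphisms are omitted (relying on coherence). The monoidal unit is $I$; the monoidal product is denoted by juxtaposition, with $A^n$ the iterated monoidal product. The braiding is $c$ (components $c_{X,Y}\colon XY\to YX$, subscripts omitted); $c^{-1}$ denotes the inverse of the appropriate component. The composite of $f\colon A\to B$ and $g\colon B\to C$ is written $g.f$; $1$ denotes identity morphisms. Juxtaposed morphisms such as $1t$, $c1$ denote monoidal products. A semigroup in $\mathcal C$ is an object $A$ with an associative morphism $m\colon A^2\to A$. $\mathcal C^{\mathsf{rev}}$ is $\mathcal C$ with reversed monoidal product and the same braiding $c$. $\overline{\mathcal C}$ is $\mathcal C$ with the same monoidal product but with braiding $c^{-1}$ in place of $c$ (so in all formulas below, passing from $\mathcal C$ to $\overline{\mathcal C}$ interchanges $c$ and $c^{-1}$). **Fusion morphisms.** A fusion morphism on $A$ in $\mathcal C$ is a morphism $t\colon A^2\to A^2$ such that $(1t).(t1)=(t1).(c^{-1}1).(1t).(c1).(1t)\colon A^3\to A^3$. A morphism $e\colon A\to I$ is a counit of $t$ if $(1e).t=1e$. Explicitly in terms of $\mathcal C$, a fusion morphism in $\mathcal C^{\mathsf{rev}}$ is $t\colon A^2\to A^2$ with $(t1).(1t)=(1t).(1c^{-1}).(t1).(1c).(t1)$,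 and $e$ is a counit of it if $(e1).t=e1$. **Multiplier bimonoids.** A multiplier bimonoid in $\mathcal C$ is a tuple $(A,t_1,t_2,e)$ where $A$ is an object of $\mathcal C$, $t_1\colon A^2\to A^2$ is a fusion morphism in $\mathcal C$ and $t_2\colon A^2\to A^2$ is a fusion morphism in $\mathcal C^{\mathsf{rev}}$ with a common counit $e\colon A\to I$, such that $(1t_1).(t_21)=(t_21).(1t_1)$ and $(1e).t_2=(e1).t_1$. **Regular multiplier bimonoids.** A regular multiplier bimonoid in $\mathcal C$ is a tuple $(A,t_1,t_2,t_3,t_4,e)$ such that $(A,t_1,t_2,e)$ is a multiplier bimonoid in $\mathcal C$, $(A,t_3,t_4,e)$ is a multiplier bimonoid in $\overline{\mathcal C}$, and, with $m$ denoting the common value in the first equation, $$m:=(e1).t_1=(e1).t_3.c\colon A^2\to A,$$ $$(1m).(c1).(1t_1)=(1m).(t_31).(c1),\qquad (t_41).(1t_1)=(1t_1).(t_41),$$ $$(m1).(1c).(t_21)=(m1).(1t_4).(1c),\qquad (1t_3).(t_21)=(t_21).(1t_3).$$ **Simplicial conventions.** Simplicial sets have face maps $d_i$ and degeneracy maps $s_i$. An $n$-boundary is an $(n+1)$-tuple $\{w_0,\dots,w_n\}$ of $(n-1)$-simplices with $d_j(w_i)=d_i(w_{j+1})$ for all $0\le i\le j<n$; a filler is an $n$-simplex $w$ with $d_i(w)=w_i$ for all $i$, and one writes $w=(w_0,\dots,w_n)$ when it is the unique filler. Simplices in given degrees are generated coskeletally if every boundary in those degrees has a unique filler. A 2-simplex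 $w$ has edges $w_{12}=d_0(w)$, $w_{02}=d_1(w)$, $w_{01}=d_2(w)$ and its boundary is written $\{w_{12},w_{02},w_{01}\}$; the boundary of a 3-simplex is written $\{w_{123},w_{023},w_{013},w_{012}\}$ (faces $d_0,d_1,d_2,d_3$), where the edges of $w_{ijk}$ are indexed $jk$, $ik$, $ij$. **Catalan simplicial set $\mathsf C$.** It has a single 0-simplex $\ast$; two 1-simplices, $s_0(\ast)$ and a non-degenerate one $\alpha$; three degenerate 2-simplices $s_0s_0(\ast)=s_1s_0(\ast)$, $s_0(\alpha)$, $s_1(\alpha)$ and two non-degenerate 2-simplices: $\tau$ with $d_0\tau=d_1\tau=d_2\tau=\alpha$, and $\varepsilon$ with $d_0\varepsilon=d_2\varepsilon=s_0(\ast)$, $d_1\varepsilon=\alpha$. All simplices of dimension $n>2$ are generated coskeletally. **Simplicial set $\mathsf M_1$.** It has a single 0-simplex $\ast$. Its 1-simplices are the semigroups $(A,m)$ in $\mathcal C$. The 2-simplices with boundary $\{A_{12},A_{02},A_{01}\}$ (with multiplications $m_{12},m_{02},m_{01}$) are the morphisms $\varphi\colon A_{02}A_{12}\to A_{01}A_{12}$ in $\mathcal C$ such that $$\varphi.(1m_{12})=(1m_{12}).(\varphi 1),\qquad \varphi.(m_{02}1)=(m_{01}1).(c^{-1}1).(1\varphi).(c1).(1\varphi).$$ A 3-boundary $\{\varphi_{123},\varphi_{023},\varphi_{013},\varphi_{012}\}$ has precisely one filler if $$(1\varphi_{123}).(\varphi_{013}1)=(\varphi_{012}1).(c^{-1}1).(1\varphi_{023}).(c1).(1\varphi_{123})\colon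 A_{03}A_{13}A_{23}\to A_{01}A_{12}A_{23},$$ and no filler otherwise. All higher simplices are generated coskeletally. The degenerate 1-simplex is $I$ (as trivial semigroup). The 2-simplex $s_0(A,m)$ (with $A_{12}=A_{02}=A$, $A_{01}=I$) is $m\colon AA\to IA\cong A$; the 2-simplex $s_1(A,m)$ (with $A_{12}=I$, $A_{02}=A_{01}=A$) is $1\colon A\to A$. On higher simplices the degeneracy maps are determined by uniqueness of the filler. **Simplicial set $\mathsf M_2$.** It has a single 0-simplex $\ast$ and its 1-simplices are the semigroups in $\mathcal C$. The 2-simplices with boundary $\{A_{12},A_{02},A_{01}\}$ are the morphisms $\psi\colon A_{01}A_{02}\to A_{01}A_{12}$ in $\mathcal C$ such that $$\psi.(m_{01}1)=(m_{01}1).(1\psi),\qquad \psi.(1m_{02})=(1m_{12}).(1c^{-1}).(\psi1).(1c).(\psi1).$$ A 3-boundary $\{\psi_{123},\psi_{023},\psi_{013},\psi_{012}\}$ has precisely one filler if $$(\psi_{012}1).(1\psi_{023})=(1\psi_{123}).(1c^{-1}).(\psi_{013}1).(1c).(\psi_{012}1)\colon A_{01}A_{02}A_{03}\to A_{01}A_{12}A_{23},$$ and no filler otherwise. All higher simplices are generated coskeletally. The degenerate 1-simplex is $I$; $s_0(A,m)$ is $1\colon A\to A$ (with $A_{01}=I$, $A_{12}=A_{02}=A$) and $s_1(A,m)$ is $m\colon AA\to AI\cong A$ (with $A_{12}=I$, $A_{01}=A_{02}=A$). On higher simplices the degeneracy maps are determined by uniqueness of the filler. **Simplicial set $\mathsf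 M_{12}$.** It has a single 0-simplex $\ast$, and its 1-simplices are the semigroups in $\mathcal C$. The 2-simplices are pairs $(\varphi\vert\psi)$ of a 2-simplex $\varphi$ of $\mathsf M_1$ and a 2-simplex $\psi$ of $\mathsf M_2$ with common boundary $\{A_{12},A_{02},A_{01}\}$ such that $$(m_{01}1).(1\varphi)=(1m_{12}).(\psi1)\colon A_{01}A_{02}A_{12}\to A_{01}A_{12}.$$ The 3-simplices are pairs $(\varphi_{123},\varphi_{023},\varphi_{013},\varphi_{012}\vert\psi_{123},\psi_{023},\psi_{013},\psi_{012})$ of a 3-simplex of $\mathsf M_1$ and a 3-simplex of $\mathsf M_2$ such that each $(\varphi_{ijk}\vert\psi_{ijk})$ is a 2-simplex of $\mathsf M_{12}$ and $$(\psi_{012}1).(1\varphi_{023})=(1\varphi_{123}).(\psi_{013}1)\colon A_{01}A_{03}A_{23}\to A_{01}A_{12}A_{23}.$$ The face and degeneracy maps act componentwise on pairs, and higher simplices are generated coskeletally. **Simplicial set $\mathsf M_{34}$.** It is obtained by applying the construction of $\mathsf M_{12}$ to $\overline{\mathcal C}$, using for each 1-simplex (semigroup) $(A,m)$ of $\mathcal C$ the reversed multiplication $m.c^{-1}$. That is: its 1-simplices are the semigroups $(A,m)$ in $\mathcal C$, and its simplices $(\varphi'\vert\psi')$ of dimension 2 and 3, together with the degeneracies, are described as for $\mathsf M_{12}$ (via $\mathsf M_1$ and $\mathsf M_2$) but with $c$ and $c^{-1}$ interchanged and with every multiplication $m$, $m_{ij}$ replaced by $m.c^{-1}$, $m_{ij}.c^{-1}$.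 In particular $s_0(A,m)=(m.c^{-1}\vert 1)$ and $s_1(A,m)=(1\vert m.c^{-1})$. **Simplicial set $\mathsf M$.** It has a single 0-simplex $\ast$, and its 1-simplices are the semigroups in $\mathcal C$. The 2-simplices are pairs $(\varphi\vert\psi\Vert\varphi'\vert\psi')$ of a 2-simplex $(\varphi\vert\psi)$ of $\mathsf M_{12}$ and a 2-simplex $(\varphi'\vert\psi')$ of $\mathsf M_{34}$ with common boundary $\{A_{12},A_{02},A_{01}\}=\{A,B,C\}$ (so $\varphi,\varphi'\colon BA\to CA$ and $\psi,\psi'\colon CB\to CA$), such that, with $m$ denoting the multiplication of the relevant semigroup, $$(m1).(c^{-1}1).(1\varphi)=(1m).(\psi'1)\colon CBA\to CA,$$ $$(1m).(1c^{-1}).(\psi1)=(m1).(1\varphi')\colon CBA\to CA,$$ $$(1m).(c1).(1\varphi)=(1m).(\varphi'1).(c1)\colon ABA\to CA,$$ $$(m1).(1c).(\psi1)=(m1).(1\psi').(1c)\colon CBC\to CA.$$ The 3-simplices are pairs consisting of a 3-simplex $(\varphi_{123},\varphi_{023},\varphi_{013},\varphi_{012}\vert\psi_{123},\psi_{023},\psi_{013},\psi_{012})$ of $\mathsf M_{12}$ and a 3-simplex $(\varphi'_{123},\varphi'_{023},\varphi'_{013},\varphi'_{012}\vert\psi'_{123},\psi'_{023},\psi'_{013},\psi'_{012})$ of $\mathsf M_{34}$ such that $(\varphi_{ijk}\vert\psi_{ijk}\Vert\varphi'_{ijk}\vert\psi'_{ijk})$ is a 2-simplex of $\mathsf M$ for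 all $0\le i<j<k\le3$ and $$(\psi'_{012}1).(1\varphi_{023})=(1\varphi_{123}).(\psi'_{013}1),\qquad (1\varphi'_{123}).(\psi_{013}1)=(\psi_{012}1).(1\varphi'_{023})$$ as morphisms $A_{01}A_{03}A_{23}\to A_{01}A_{12}A_{23}$. The higher simplices are generated coskeletally, and the face and degeneracy maps act memberwise on the pairs. *)

(* Defs.v *)
From mathcomp Require Import all_boot zify.
From Stdlib Require Import FunctionalExtensionality ProofIrrelevance.

Set Implicit Arguments.
Unset Strict Implicit.
Unset Printing Implicit Defensive.

Declare Scope cat_scope.
Delimit Scope cat_scope with cat.
Local Open Scope cat_scope.

Record category := Category {
  ob :> Type;
  hom : ob -> ob -> Type;
  idm : forall X, hom X X;
  comp : forall X Y Z, hom Y Z -> hom X Y -> hom X Z;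
  comp1m : forall X Y (f : hom X Y), comp (idm Y) f = f;
  compm1 : forall X Y (f : hom X Y), comp f (idm X) = f;
  compA : forall W X Y Z (h : hom Y Z) (g : hom X Y) (f : hom W X),
    comp (comp h g) f = comp h (comp g f)
}.

Arguments idm {c} X.
Notation "g ∘ f" := (comp g f) (at level 45, right associativity) : cat_scope.

Record monoidal_category := MonoidalCategory {
  mcat :> category;
  unit_ob : mcat;
  tens : mcat -> mcat -> mcat;
  tensm : forall A B C D : mcat,
    hom A B -> hom C D -> hom (tens A C) (tens B D);
  assoc : forall X Y Z, hom (tens (tens X Y) Z) (tens X (tens Y Z));
  associ : forall X Y Z, hom (tens X (tens Y Z)) (tens (tens X Y) Z);
  lunit : forall X, hom (tens unit_ob X) X;
  luniti : forall X, hom X (tens unit_ob X);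
  runit : forall X, hom (tens X unit_ob) X;
  runiti : forall X, hom X (tens X unit_ob);
  tensm1 : forall X Y, tensm (idm X) (idm Y) = idm (tens X Y);
  tensm_comp : forall A B C A' B' C' (g : hom B C) (f : hom A B)
    (g' : hom B' C') (f' : hom A' B'),
    tensm (g ∘ f) (g' ∘ f') = tensm g g' ∘ tensm f f';
  assocK : forall X Y Z, associ X Y Z ∘ assoc X Y Z = idm _;
  associK : forall X Y Z, assoc X Y Z ∘ associ X Y Z = idm _;
  lunitK : forall X, luniti X ∘ lunit X = idm _;
  lunitiK : forall X, lunit X ∘ luniti X = idm _;
  runitK : forall X, runiti X ∘ runit X = idm _;
  runitiK : forall X, runit X ∘ runiti X = idm _;
  assoc_nat : forall X X' Y Y' Z Z' (f : hom X X') (g : hom Y Y') (h : hom Z Z'),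
    assoc X' Y' Z' ∘ tensm (tensm f g) h = tensm f (tensm g h) ∘ assoc X Y Z;
  lunit_nat : forall X Y (f : hom X Y),
    lunit Y ∘ tensm (idm unit_ob) f = f ∘ lunit X;
  runit_nat : forall X Y (f : hom X Y),
    runit Y ∘ tensm f (idm unit_ob) = f ∘ runit X;
  pentagon : forall W X Y Z,
    tensm (idm W) (assoc X Y Z) ∘ assoc W (tens X Y) Z
      ∘ tensm (assoc W X Y) (idm Z)
    = assoc W X (tens Y Z) ∘ assoc (tens W X) Y Z;
  triangle : forall X Y,
    tensm (idm X) (lunit Y) ∘ assoc X unit_ob Y = tensm (runit X) (idm Y)
}.

Arguments unit_ob {m}.
Arguments assoc {m} X Y Z.
Arguments associ {m} X Y Z.
Arguments lunit {m} X.
Arguments luniti {m} X.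
Arguments runit {m} X.
Arguments runiti {m} X.
Notation "'𝟙'" := unit_ob : cat_scope.
Notation "X ⊗ Y" := (tens X Y) (at level 32, left associativity) : cat_scope.
Notation "f ⊠ g" := (tensm f g) (at level 32, left associativity) : cat_scope.

(* [brinv X Y] is the inverse of the component [br Y X]. *)
Record braided_category := BraidedCategory {
  bmcat :> monoidal_category;
  br : forall X Y : bmcat, hom (X ⊗ Y) (Y ⊗ X);
  brinv : forall X Y : bmcat, hom (X ⊗ Y) (Y ⊗ X);
  brK : forall X Y, brinv Y X ∘ br X Y = idm _;
  brinvK : forall X Y, br Y X ∘ brinv X Y = idm _;
  br_nat : forall X X' Y Y' (f : hom X X') (g : hom Y Y'),
    br X' Y' ∘ (f ⊠ g) = (g ⊠ f) ∘ br X Y;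
  hexagon1 : forall X Y Z,
    assoc Y Z X ∘ br X (Y ⊗ Z) ∘ assoc X Y Z
    = (idm Y ⊠ br X Z) ∘ assoc Y X Z ∘ (br X Y ⊠ idm Z);
  hexagon2 : forall X Y Z,
    associ Z X Y ∘ br (X ⊗ Y) Z ∘ associ X Y Z
    = (br X Z ⊠ idm Y) ∘ associ X Z Y ∘ (idm X ⊠ br Y Z)
}.

Arguments br {b} X Y.
Arguments brinv {b} X Y.

Section CatTheory.
Variable C : category.
Implicit Types X Y Z : C.

Lemma compR X Y Z (g : hom Y Z) (f : hom X Y) (h : hom X Z) :
  g ∘ f = h -> forall W (k : hom W X), g ∘ f ∘ k = h ∘ k.
Proof. by move=> <- W k; rewrite compA. Qed.

Lemma comp_isoL X Y Z (p : hom Y Z) (q : hom Z Y) (f g : hom X Y) :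
  q ∘ p = idm _ -> p ∘ f = p ∘ g -> f = g.
Proof. by move=> qp e; rewrite -(comp1m f) -(comp1m g) -qp !compA e. Qed.

Lemma comp_isoR X Y Z (p : hom X Y) (q : hom Y X) (f g : hom Y Z) :
  p ∘ q = idm _ -> f ∘ p = g ∘ p -> f = g.
Proof. by move=> pq e; rewrite -(compm1 f) -(compm1 g) -pq -!compA e. Qed.

End CatTheory.

(* [rw e] rewrites with [e] modulo associativity of composition. *)
Ltac cA := repeat match goal with
  |- context [comp (comp ?h ?g) ?f] => rewrite (compA h g f) end.
Ltac c1 := repeat (rewrite comp1m || rewrite compm1).
Ltac rw e := (first [rewrite (compR e) | rewrite e]); cA.

Section MonTheory.
Variable C : monoidal_category.
Implicit Types X Y Z : C.

Lemma tens1_comp X Y Z W (g : hom Y Z) (f : hom X Y) :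
  idm W ⊠ (g ∘ f) = (idm W ⊠ g) ∘ (idm W ⊠ f).
Proof. by rewrite -tensm_comp comp1m. Qed.

Lemma tens_comp1 X Y Z W (g : hom Y Z) (f : hom X Y) :
  (g ∘ f) ⊠ idm W = (g ⊠ idm W) ∘ (f ⊠ idm W).
Proof. by rewrite -tensm_comp comp1m. Qed.

Lemma tens_xl X Y Z W (g : hom Z W) (f : hom X Y) :
  (f ⊠ idm W) ∘ (idm X ⊠ g) = f ⊠ g.
Proof. by rewrite -tensm_comp compm1 comp1m. Qed.

Lemma tens_xr X Y Z W (g : hom Z W) (f : hom X Y) :
  (idm Y ⊠ g) ∘ (f ⊠ idm Z) = f ⊠ g.
Proof. by rewrite -tensm_comp compm1 comp1m. Qed.

Lemma tens_x X Y Z W (g : hom Z W) (f : hom X Y) :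
  (idm Y ⊠ g) ∘ (f ⊠ idm Z) = (f ⊠ idm W) ∘ (idm X ⊠ g).
Proof. by rewrite tens_xl tens_xr. Qed.

Lemma associ_nat X X' Y Y' Z Z' (f : hom X X') (g : hom Y Y') (h : hom Z Z') :
  associ X' Y' Z' ∘ (f ⊠ (g ⊠ h)) = ((f ⊠ g) ⊠ h) ∘ associ X Y Z.
Proof.
apply: (comp_isoL (assocK X' Y' Z')).
rw (associK X' Y' Z'); rewrite comp1m; rw (assoc_nat f g h).
by rewrite ?compA associK compm1.
Qed.

Lemma luniti_nat X Y (f : hom X Y) :
  luniti Y ∘ f = (idm 𝟙 ⊠ f) ∘ luniti X.
Proof.
apply: (comp_isoL (lunitK Y)); rw (lunitiK Y); rw (lunit_nat f).
by rewrite ?compA lunitiK compm1 comp1m.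
Qed.

Lemma runiti_nat X Y (f : hom X Y) :
  runiti Y ∘ f = (f ⊠ idm 𝟙) ∘ runiti X.
Proof.
apply: (comp_isoL (runitK Y)); rw (runitiK Y); rw (runit_nat f).
by rewrite ?compA runitiK compm1 comp1m.
Qed.

Lemma tens1_inj X Y (f g : hom X Y) : idm 𝟙 ⊠ f = idm 𝟙 ⊠ g -> f = g.
Proof.
move=> e; apply: (comp_isoR (lunitiK X)); by rewrite -!lunit_nat e.
Qed.

Lemma tens_inj1 X Y (f g : hom X Y) : f ⊠ idm 𝟙 = g ⊠ idm 𝟙 -> f = g.
Proof.
move=> e; apply: (comp_isoR (runitiK X)); by rewrite -!runit_nat e.
Qed.

Lemma tensl_iso X Y Z (p : hom X Y) (q : hom Y X) :
  q ∘ p = idm _ -> (q ⊠ idm Z) ∘ (p ⊠ idm Z) = idm _.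
Proof. by move=> qp; rewrite -tensm_comp qp comp1m tensm1. Qed.

Lemma tensr_iso X Y Z (p : hom X Y) (q : hom Y X) :
  q ∘ p = idm _ -> (idm Z ⊠ q) ∘ (idm Z ⊠ p) = idm _.
Proof. by move=> qp; rewrite -tensm_comp qp comp1m tensm1. Qed.

Lemma lunit_tens X Y : lunit (X ⊗ Y) ∘ assoc 𝟙 X Y = lunit X ⊠ idm Y.
Proof.
apply: tens1_inj; rewrite tens1_comp.
apply: (comp_isoR (associK 𝟙 (𝟙 ⊗ X) Y)).
apply: (comp_isoR (tensl_iso Y (associK 𝟙 𝟙 X))).
rewrite !compA pentagon; rw (esym (assoc_nat (idm 𝟙) (lunit X) (idm Y))).
rw (triangle 𝟙 (X ⊗ Y)).
rewrite -tensm_comp comp1m triangle -(tensm1 X Y).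
by rewrite assoc_nat.
Qed.

Lemma runit_tens X Y : (idm X ⊠ runit Y) ∘ assoc X Y 𝟙 = runit (X ⊗ Y).
Proof.
apply: tens_inj1; rewrite tens_comp1.
apply: (comp_isoL (assocK X Y 𝟙)).
rw (assoc_nat (idm X) (runit Y) (idm 𝟙)).
rewrite -(triangle Y) tens1_comp !compA pentagon -(triangle (X ⊗ Y)).
by rw (esym (assoc_nat (idm X) (idm Y) (lunit 𝟙))); rewrite tensm1.
Qed.

Lemma lunit_lunit X : idm 𝟙 ⊠ lunit X = lunit (𝟙 ⊗ X).
Proof. by apply: (comp_isoL (lunitK X)); rewrite lunit_nat. Qed.

Lemma lunit_runit1 : lunit 𝟙 = runit 𝟙 :> hom (𝟙 ⊗ 𝟙 : C) 𝟙.
Proof.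
apply: tens_inj1; rewrite -triangle -lunit_tens.
by rewrite lunit_lunit.
Qed.

Lemma luniti_runiti1 : luniti 𝟙 = runiti 𝟙 :> hom (𝟙 : C) (𝟙 ⊗ 𝟙).
Proof.
apply: (comp_isoL (lunitK 𝟙)); rewrite lunitiK.
by rewrite lunit_runit1 runitiK.
Qed.

End MonTheory.

(* [X ◁ f] and [X ◂ f] are the morphisms written [1f] in the strict case;
   threefold products are always bracketed to the left. *)
Definition lwhisk (C : monoidal_category) (X A B A' B' : C)
    (f : hom (A ⊗ B) (A' ⊗ B')) : hom (X ⊗ A ⊗ B) (X ⊗ A' ⊗ B') :=
  associ X A' B' ∘ (idm X ⊠ f) ∘ assoc X A B.

Definition lwhiskm (C : monoidal_category) (X A B D : C)
    (f : hom (A ⊗ B) D) : hom (X ⊗ A ⊗ B) (X ⊗ D) :=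
  (idm X ⊠ f) ∘ assoc X A B.

Notation "X ◁ f" := (lwhisk X f) (at level 35, right associativity) : cat_scope.
Notation "X ◂ f" := (lwhiskm X f) (at level 35, right associativity) : cat_scope.
Notation "f ▷ X" := (f ⊠ idm X) (at level 33, left associativity) : cat_scope.

Section Bar.
Variable C : braided_category.

Lemma brinv_nat (X X' Y Y' : C) (f : hom X X') (g : hom Y Y') :
  brinv X' Y' ∘ (f ⊠ g) = (g ⊠ f) ∘ brinv X Y.
Proof.
apply: (comp_isoL (brK Y' X')); rw (brinvK X' Y'); rewrite comp1m.
rw (br_nat g f). by rewrite ?compA brinvK compm1.
Qed.

Lemma bar_hexagon1 (X Y Z : C) :
  assoc Y Z X ∘ brinv X (Y ⊗ Z) ∘ assoc X Y Z
  = (idm Y ⊠ brinv X Z) ∘ assoc Y X Z ∘ (brinv X Y ⊠ idm Z).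
Proof.
have E := hexagon2 Y Z X.
apply: (comp_isoR (assocK _ _ _)); rewrite !compA associK compm1.
apply: (comp_isoR (brinvK _ _)); rewrite !compA brK compm1.
apply: (comp_isoR (assocK _ _ _)); rewrite associK !compA E.
rw (tensl_iso Z (brK Y X)); rewrite comp1m.
rw (associK Y X Z); rewrite comp1m.
by rewrite (tensr_iso Y (brK Z X)).
Qed.

Lemma bar_hexagon2 (X Y Z : C) :
  associ Z X Y ∘ brinv (X ⊗ Y) Z ∘ associ X Y Z
  = (brinv X Z ⊠ idm Y) ∘ associ X Z Y ∘ (idm X ⊠ brinv Y Z).
Proof.
have E := hexagon1 Z X Y.
apply: (comp_isoR (associK _ _ _)); rewrite !compA assocK compm1.
apply: (comp_isoR (brinvK _ _)); rewrite !compA brK compm1.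
apply: (comp_isoR (associK _ _ _)); rewrite assocK !compA E.
rw (tensr_iso X (brK Z Y)); rewrite comp1m.
rw (assocK X Z Y); rewrite comp1m.
by rewrite (tensl_iso Y (brK Z X)).
Qed.

Definition bar : braided_category :=
  BraidedCategory (@brinvK C) (@brK C) brinv_nat bar_hexagon1 bar_hexagon2.

End Bar.

(* [inord] is only applied to in-range values in the simplicial identities. *)
Record sset := SSet {
  simp : nat -> Type;
  face : forall n, 'I_n.+2 -> simp n.+1 -> simp n;
  degen : forall n, 'I_n.+1 -> simp n -> simp n.+1;
  face_face : forall n (x : simp n.+2) i j, i <= j < n.+2 ->
    face (inord j) (face (inord i) x) = face (inord i) (face (inord j.+1) x);
  face_degen_lt : forall n (x : simp n.+1) i j, i < j < n.+2 ->
    face (inord i) (degen (inord j) x) = degen (inord j.-1) (face (inord i) x);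
  face_degen_eq : forall n (x : simp n) i j, j < n.+1 -> i = j \/ i = j.+1 ->
    face (inord i) (degen (inord j) x) = x;
  face_degen_gt : forall n (x : simp n.+1) i j, j.+1 < i < n.+3 ->
    face (inord i) (degen (inord j) x) = degen (inord j) (face (inord i.-1) x);
  degen_degen : forall n (x : simp n) i j, i <= j < n.+1 ->
    degen (inord i) (degen (inord j) x)
    = degen (inord j.+1) (degen (inord i) x)
}.

Record sset_map (X Y : sset) := SSetMap {
  smap :> forall n, simp X n -> simp Y n;
  smap_face : forall n (i : 'I_n.+2) (x : simp X n.+1),
    smap (face i x) = face i (smap x);
  smap_degen : forall n (i : 'I_n.+1) (x : simp X n),
    smap (degen i x) = degen i (smap x)
}.

(* Three consecutive levels of a simplicial set, in dimensions n, n+1, n+2. *)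
Record tier (n : nat) := Tier {
  lo : Type; mid : Type; top : Type;
  dlo : 'I_n.+2 -> mid -> lo;
  dtop : 'I_n.+3 -> top -> mid;
  slo : 'I_n.+1 -> lo -> mid;
  stop : 'I_n.+2 -> mid -> top;
  tier_dd : forall (x : top) i j, i <= j < n.+2 ->
    dlo (inord j) (dtop (inord i) x) = dlo (inord i) (dtop (inord j.+1) x);
  tier_ds_lt : forall (x : mid) i j, i < j < n.+2 ->
    dtop (inord i) (stop (inord j) x) = slo (inord j.-1) (dlo (inord i) x);
  tier_ds_eq : forall (x : mid) i j, j < n.+2 -> i = j \/ i = j.+1 ->
    dtop (inord i) (stop (inord j) x) = x;
  tier_ds_gt : forall (x : mid) i j, j.+1 < i < n.+3 ->
    dtop (inord i) (stop (inord j) x) = slo (inord j) (dlo (inord i.-1) x);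
  tier_ss : forall (x : lo) i j, i <= j < n.+1 ->
    stop (inord i) (slo (inord j) x) = stop (inord j.+1) (slo (inord i) x)
}.

Section Step.
Variables (n : nat) (T : tier n).

Definition boundary (w : 'I_n.+4 -> top T) : Prop :=
  forall i j, i <= j < n.+3 ->
    dtop (inord j) (w (inord i)) = dtop (inord i) (w (inord j.+1)).

Definition degen_boundary (j : 'I_n.+3) (x : top T) (i : 'I_n.+4) : top T :=
  if i < j then stop (inord j.-1) (dtop (inord i) x)
  else if j.+1 < i then stop (inord j) (dtop (inord i.-1) x)
  else x.

Lemma degen_boundary_lt x i j : i < j < n.+3 ->
  degen_boundary (inord j) x (inord i) = stop (inord j.-1) (dtop (inord i) x).
Proof.
move=> h; rewrite /degen_boundary !inordK; try lia.
by have -> : i < j by lia.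
Qed.

Lemma degen_boundary_eq x i j : j < n.+3 -> i = j \/ i = j.+1 ->
  degen_boundary (inord j) x (inord i) = x.
Proof.
move=> h h'; rewrite /degen_boundary !inordK; try lia.
have -> : (i < j) = false by lia.
by have -> : (j.+1 < i) = false by lia.
Qed.

Lemma degen_boundary_gt x i j : j.+1 < i < n.+4 ->
  degen_boundary (inord j) x (inord i) = stop (inord j) (dtop (inord i.-1) x).
Proof.
move=> h; rewrite /degen_boundary !inordK; try lia.
have -> : (i < j) = false by lia.
by have -> : j.+1 < i by lia.
Qed.

Lemma degen_boundaryP j x : boundary (degen_boundary j x).
Proof.
have [m [hm ->]] : exists m, m < n.+3 /\ j = inord m.
  by exists j; rewrite inord_val.
move: m hm => {}j hj.
move=> i k h; have [lij|] := ltnP i j.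
  rewrite degen_boundary_lt; last by lia.
  have [lkj|] := ltnP k.+1 j.
    rewrite degen_boundary_lt; last by lia.
    rewrite !tier_ds_lt; try lia.
    by rewrite tier_dd //; lia.
  move=> lejk; have [lkj|] := leqP k j.
    rewrite tier_ds_eq; try lia.
    by rewrite degen_boundary_eq //; lia.
  move=> ljk; rewrite degen_boundary_gt; last by lia.
  rewrite tier_ds_gt; last by lia.
  rewrite tier_ds_lt; last by lia.
  by rewrite tier_dd ?prednK //; lia.
move=> leji; have [leij|] := leqP i j.+1.
  rewrite degen_boundary_eq; try lia.
  have [lekj|ljk] := leqP k j.
    rewrite degen_boundary_eq; try lia.
    by have -> : k = i by lia.
  rewrite degen_boundary_gt; last by lia.
  by rewrite tier_ds_eq //; lia.
move=> lji; rewrite !degen_boundary_gt; try lia.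
rewrite !tier_ds_gt; try lia.
by rewrite tier_dd ?prednK //; lia.
Qed.

Variable P : ('I_n.+4 -> top T) -> Prop.
Hypothesis HP : forall j x, P (degen_boundary j x).

Record filled := Filled {
  fill :> 'I_n.+4 -> top T;
  fill_boundary : boundary fill;
  fill_prop : P fill
}.

Lemma filled_eq (u v : filled) : (forall i, i < n.+4 -> u (inord i) = v (inord i)) -> u = v.
Proof.
case: u v => [u bu pu] [v bv pv] /= e.
have E : u = v.
  by apply: functional_extensionality => i; rewrite -(inord_val i); apply: e.
subst v; by rewrite (proof_irrelevance _ bu bv) (proof_irrelevance _ pu pv).
Qed.

Definition fdegen j x : filled := Filled (@degen_boundaryP j x) (HP j x).

Lemma step_ds_lt (x : top T) i j : i < j < n.+3 ->
  fdegen (inord j) x (inord i) = stop (inord j.-1) (dtop (inord i) x).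
Proof. exact: degen_boundary_lt. Qed.

Lemma step_ds_eq (x : top T) i j : j < n.+3 -> i = j \/ i = j.+1 ->
  fdegen (inord j) x (inord i) = x.
Proof. exact: degen_boundary_eq. Qed.

Lemma step_ds_gt (x : top T) i j : j.+1 < i < n.+4 ->
  fdegen (inord j) x (inord i) = stop (inord j) (dtop (inord i.-1) x).
Proof. exact: degen_boundary_gt. Qed.

Lemma step_ss (x : mid T) i j : i <= j < n.+2 ->
  fdegen (inord i) (stop (inord j) x) = fdegen (inord j.+1) (stop (inord i) x).
Proof.
move=> h; apply: filled_eq => k hk.
have [lki|leik] := ltnP k i.
  rewrite !step_ds_lt; try lia.
  rewrite !tier_ds_lt; try lia.
  by rewrite tier_ss ?prednK //; lia.
have [leki|lik] := leqP k i.+1.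
  rewrite step_ds_eq; try lia.
  have [lkj|lejk] := ltnP k j.+1.
    rewrite step_ds_lt; last by lia.
    by rewrite tier_ds_eq //; lia.
  rewrite step_ds_eq; try lia.
  by have -> : i = j by lia.
rewrite step_ds_gt; last by lia.
have [lkj|lejk] := ltnP k j.+1.
  rewrite step_ds_lt; last by lia.
  rewrite tier_ds_lt; last by lia.
  rewrite tier_ds_gt; last by lia.
  by rewrite tier_ss ?prednK //; lia.
have [lekj|ljk] := leqP k j.+2.
  rewrite step_ds_eq; try lia.
  by rewrite tier_ds_eq //; lia.
rewrite step_ds_gt; last by lia.
rewrite !tier_ds_gt; try lia.
by rewrite tier_ss //; lia.
Qed.

Definition step : tier n.+1 :=
  @Tier n.+1 (mid T) (top T) filled (@dtop n T) (fun i u => u i) (@stop n T) fdegen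
    (fun u i j h => fill_boundary u h) step_ds_lt step_ds_eq step_ds_gt step_ss.

End Step.

(* The simplicial set with levels [T0] in dimensions 0, 1, 2, whose 3-simplices
   are the boundaries satisfying [P], and whose n-simplices for n > 3 are all
   the boundaries of dimension n. *)
Section Tower.
Variables (T0 : tier 0) (P : ('I_4 -> top T0) -> Prop).
Hypothesis HP : forall j x, P (degen_boundary j x).

Fixpoint tower k : tier k.+1 :=
  match k with
  | 0 => step HP
  | k'.+1 => @step _ (tower k') (fun _ => True) (fun _ _ => I)
  end.

Definition gen_simp n : Type :=
  match n with
  | 0 => lo T0
  | 1 => mid T0
  | 2 => top T0
  | k.+3 => top (tower k)
  end.

Definition gen_face n : 'I_n.+2 -> gen_simp n.+1 -> gen_simp n :=
  match n with
  | 0 => @dlo _ T0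
  | 1 => @dtop _ T0
  | 2 => @dtop _ (tower 0)
  | k.+3 => @dtop _ (tower k.+1)
  end.

Definition gen_degen n : 'I_n.+1 -> gen_simp n -> gen_simp n.+1 :=
  match n with
  | 0 => @slo _ T0
  | 1 => @stop _ T0
  | 2 => @stop _ (tower 0)
  | k.+3 => @stop _ (tower k.+1)
  end.

Hypothesis base_ds_eq : forall (x : lo T0) i j, j < 1 -> i = j \/ i = j.+1 ->
  dlo (inord i) (slo (inord j) x) = x.

Program Definition gen_sset : sset :=
  @SSet gen_simp gen_face gen_degen _ _ _ _ _.
Next Obligation.
case: n x H => [|[|[|n]]] x H.
- exact: tier_dd.
- exact: (@tier_dd _ (tower 0)).
- exact: (@tier_dd _ (tower 1)).
exact: (@tier_dd _ (tower n.+2)).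
Qed.
Next Obligation.
case: n x H => [|[|[|n]]] x H.
- exact: tier_ds_lt.
- exact: (@tier_ds_lt _ (tower 0)).
- exact: (@tier_ds_lt _ (tower 1)).
exact: (@tier_ds_lt _ (tower n.+2)).
Qed.
Next Obligation.
case: n x H => [|[|[|[|n]]]] x H.
- exact: base_ds_eq.
- exact: tier_ds_eq.
- exact: (@tier_ds_eq _ (tower 0)).
- exact: (@tier_ds_eq _ (tower 1)).
exact: (@tier_ds_eq _ (tower n.+2)).
Qed.
Next Obligation.
case: n x H => [|[|[|n]]] x H.
- exact: tier_ds_gt.
- exact: (@tier_ds_gt _ (tower 0)).
- exact: (@tier_ds_gt _ (tower 1)).
exact: (@tier_ds_gt _ (tower n.+2)).
Qed.
Next Obligation.
case: n x H => [|[|[|n]]] x H.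
- exact: tier_ss.
- exact: (@tier_ss _ (tower 0)).
- exact: (@tier_ss _ (tower 1)).
exact: (@tier_ss _ (tower n.+2)).
Qed.

End Tower.

Inductive catalan1 := Cat_unit | Cat_alpha.
Inductive catalan2 :=
  Cat_unit2 | Cat_s0_alpha | Cat_s1_alpha | Cat_tau | Cat_epsilon.

Definition catalan_face1 (i : 'I_3) (w : catalan2) : catalan1 :=
  match w, nat_of_ord i with
  | Cat_unit2, _ => Cat_unit
  | Cat_s0_alpha, 2 => Cat_unit
  | Cat_s0_alpha, _ => Cat_alpha
  | Cat_s1_alpha, 0 => Cat_unit
  | Cat_s1_alpha, _ => Cat_alpha
  | Cat_tau, _ => Cat_alpha
  | Cat_epsilon, 1 => Cat_alpha
  | Cat_epsilon, _ => Cat_unit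
  end.

Definition catalan_degen1 (j : 'I_2) (a : catalan1) : catalan2 :=
  match a, nat_of_ord j with
  | Cat_unit, _ => Cat_unit2
  | Cat_alpha, 0 => Cat_s0_alpha
  | Cat_alpha, _ => Cat_s1_alpha
  end.

Definition catalan_base : tier 0.
Proof.
refine (@Tier 0 unit catalan1 catalan2 (fun _ _ => tt) catalan_face1
  (fun _ _ => Cat_unit) catalan_degen1 _ _ _ _ _).
- by [].
- move=> a i j h; have [-> ->] : i = 0 /\ j = 1 by lia.
  by case: a; rewrite /catalan_face1 /catalan_degen1 ?inordK.
- move=> a i [|[|j]] // _ [->|->];
  by case: a; rewrite /catalan_face1 /catalan_degen1 ?inordK.
- move=> a i j h; have [-> ->] : i = 2 /\ j = 0 by lia.
  by case: a; rewrite /catalan_face1 /catalan_degen1 ?inordK.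
by [].
Defined.

Definition catalan_sset : sset :=
  @gen_sset catalan_base (fun _ => True) (fun _ _ => I)
    (fun x _ _ _ _ => let: tt := x in erefl).

Section WhiskerTheory.
Variable C : monoidal_category.
Implicit Types X Y Z A B D : C.

Lemma lwhisk1 X A B : X ◁ idm (A ⊗ B) = idm (X ⊗ A ⊗ B).
Proof. by rewrite /lwhisk tensm1 comp1m assocK. Qed.

Lemma lwhisk_comp X A B A' B' A'' B'' (g : hom (A' ⊗ B') (A'' ⊗ B''))
    (f : hom (A ⊗ B) (A' ⊗ B')) : X ◁ (g ∘ f) = (X ◁ g) ∘ (X ◁ f).
Proof.
rewrite /lwhisk !compA; rw (associK X A' B').
by rewrite comp1m tens1_comp !compA.
Qed.

Lemma lwhiskm_comp X A B A' B' D (m : hom (A' ⊗ B') D)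
    (f : hom (A ⊗ B) (A' ⊗ B')) : X ◂ (m ∘ f) = (X ◂ m) ∘ (X ◁ f).
Proof.
rewrite /lwhisk /lwhiskm !compA; rw (associK X A' B').
by rewrite comp1m tens1_comp !compA.
Qed.

Lemma associ_luniti X Y : associ X 𝟙 Y ∘ (idm X ⊠ luniti Y) = runiti X ▷ Y.
Proof.
apply: (comp_isoR (tensr_iso X (lunitiK Y))).
apply: (comp_isoR (associK X 𝟙 Y)).
rewrite !compA; rw (tensr_iso X (lunitK Y)); rewrite comp1m assocK triangle.
by rewrite (tensl_iso Y (runitK X)).
Qed.

Lemma associ_runiti X Y : associ X Y 𝟙 ∘ (idm X ⊠ runiti Y) = runiti (X ⊗ Y).
Proof.
apply: (comp_isoR (tensr_iso X (runitiK Y))).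
apply: (comp_isoR (associK X Y 𝟙)).
rewrite !compA; rw (tensr_iso X (runitK Y)).
by rewrite comp1m assocK runit_tens runitK.
Qed.

Lemma lwhisk_luniti X A B D (m : hom (A ⊗ B) D) :
  X ◁ (luniti D ∘ m) = (runiti X ▷ D) ∘ (X ◂ m).
Proof. by rewrite /lwhisk /lwhiskm tens1_comp !compA; rw (associ_luniti X D). Qed.

Lemma lwhisk_runiti X A B D (m : hom (A ⊗ B) D) :
  X ◁ (runiti D ∘ m) = runiti (X ⊗ D) ∘ (X ◂ m).
Proof. by rewrite /lwhisk /lwhiskm tens1_comp !compA; rw (associ_runiti X D). Qed.

Lemma lwhiskm_lunit X A : X ◂ lunit A = runit X ▷ A.
Proof. exact: triangle. Qed.

Lemma lwhiskm_runit X A : X ◂ runit A = runit (X ⊗ A).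
Proof. exact: runit_tens. Qed.

Lemma luniti_tens X Y : luniti X ▷ Y = associ 𝟙 X Y ∘ luniti (X ⊗ Y).
Proof.
apply: (comp_isoR (tensl_iso Y (lunitiK X))); rewrite (tensl_iso Y (lunitK X)).
by rewrite -lunit_tens compA; rw (lunitK (X ⊗ Y)); rewrite comp1m assocK.
Qed.

Lemma unit_lwhiskm A B D (m : hom (A ⊗ B) D) :
  (𝟙 ◂ m) ∘ (luniti A ▷ B) = luniti D ∘ m.
Proof.
rewrite /lwhiskm luniti_tens !compA; rw (associK 𝟙 A B).
by rewrite comp1m luniti_nat.
Qed.

Lemma unit_lwhisk A B A' B' (f : hom (A ⊗ B) (A' ⊗ B')) :
  (𝟙 ◁ f) ∘ (luniti A ▷ B) = (luniti A' ▷ B') ∘ f.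
Proof.
rewrite /lwhisk !luniti_tens !compA; rw (associK 𝟙 A B).
by rewrite comp1m luniti_nat.
Qed.

Lemma unit_lwhiskm' A B D (m : hom (A ⊗ B) D) :
  𝟙 ◂ m = luniti D ∘ m ∘ (lunit A ▷ B).
Proof.
by rw (esym (unit_lwhiskm m)); rewrite ?compA (tensl_iso B (lunitK A)) compm1.
Qed.

Lemma unit_lwhisk' A B A' B' (f : hom (A ⊗ B) (A' ⊗ B')) :
  𝟙 ◁ f = (luniti A' ▷ B') ∘ f ∘ (lunit A ▷ B).
Proof.
by rw (esym (unit_lwhisk f)); rewrite ?compA (tensl_iso B (lunitK A)) compm1.
Qed.

Lemma rwhisk_unit X Y (f : hom X Y) : f ▷ 𝟙 = runiti Y ∘ f ∘ runit X.
Proof. by rw (runiti_nat f); rewrite ?compA runitK compm1. Qed.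

Lemma lwhiskm_natl X X' A B D (h : hom X X') (m : hom (A ⊗ B) D) :
  (X' ◂ m) ∘ (h ▷ A ▷ B) = (h ▷ D) ∘ (X ◂ m).
Proof.
rewrite /lwhiskm compA assoc_nat tensm1; rw (tens_x m h).
by rewrite ?compA.
Qed.

Lemma lwhisk_natl X X' A B A' B' (h : hom X X') (f : hom (A ⊗ B) (A' ⊗ B')) :
  (X' ◁ f) ∘ (h ▷ A ▷ B) = (h ▷ A' ▷ B') ∘ (X ◁ f).
Proof.
rewrite /lwhisk !compA assoc_nat tensm1; rw (tens_x f h).
have E := associ_nat h (idm A') (idm B').
rewrite tensm1 in E; by rw E.
Qed.

End WhiskerTheory.

Section BraidUnit.
Variable C : braided_category.

Lemma br_unitr (X : C) : br X 𝟙 = luniti X ∘ runit X.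
Proof.
suff E : lunit X ∘ br X 𝟙 = runit X.
  by rewrite -E; rw (lunitK X); rewrite comp1m.
apply: tens_inj1; apply: (comp_isoL (brK X 𝟙)).
have E := hexagon1 X 𝟙 𝟙.
have {}E := f_equal (comp (lunit (𝟙 ⊗ X))) E.
move: E; rw (lunit_tens 𝟙 X); rw (lunit_nat (br X 𝟙)); rw (lunit_tens X 𝟙).
rw (esym (br_nat (idm X) (lunit 𝟙))); rewrite triangle => ->.
by rewrite tens_comp1.
Qed.

End BraidUnit.

Section BraidTheory.
Variable C : braided_category.
Implicit Types X Y Z A B D : C.

Lemma brinv_unitr X : brinv X 𝟙 = luniti X ∘ runit X.
Proof. exact: (@br_unitr (bar C) X). Qed.

Lemma br_unitl X : br 𝟙 X = runiti X ∘ lunit X.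
Proof.
apply: (comp_isoL (brinvK X 𝟙)); rewrite brK brinv_unitr !compA.
by rw (runitiK X); rewrite comp1m lunitK.
Qed.

Lemma brinv_unitl X : brinv 𝟙 X = runiti X ∘ lunit X.
Proof.
apply: (comp_isoL (brK X 𝟙)); rewrite brinvK br_unitr !compA.
by rw (runitiK X); rewrite comp1m lunitK.
Qed.

Lemma brinv_unit : brinv 𝟙 𝟙 = idm (𝟙 ⊗ 𝟙 : C).
Proof. by rewrite brinv_unitr -lunit_runit1 lunitK. Qed.

Lemma br_unit : br 𝟙 𝟙 = idm (𝟙 ⊗ 𝟙 : C).
Proof. by rewrite br_unitr -lunit_runit1 lunitK. Qed.

Lemma lwhisk_brK X A B : (X ◁ brinv B A) ∘ (X ◁ br A B) = idm (X ⊗ A ⊗ B).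
Proof. by rewrite -lwhisk_comp brK lwhisk1. Qed.

End BraidTheory.

Record semigroup (C : monoidal_category) := Semigroup {
  carrier :> C;
  mul : hom (carrier ⊗ carrier) carrier;
  mulA : mul ∘ (mul ▷ carrier) = mul ∘ (carrier ◂ mul)
}.

Arguments mul {C} s.

Lemma unit_mulA (C : monoidal_category) :
  lunit 𝟙 ∘ (lunit 𝟙 ▷ 𝟙) = lunit 𝟙 ∘ (𝟙 ◂ lunit 𝟙) :> hom (𝟙 ⊗ 𝟙 ⊗ 𝟙 : C) 𝟙.
Proof. by rewrite lwhiskm_lunit lunit_runit1. Qed.

Definition unit_semigroup C : semigroup C := Semigroup (@unit_mulA C).

Lemma rev_mulA (C : braided_category) (A : semigroup C) :
  (mul A ∘ brinv A A) ∘ ((mul A ∘ brinv A A) ▷ A)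
  = (mul A ∘ brinv A A) ∘ (A ◂ (mul A ∘ brinv A A)).
Proof.
rewrite /lwhiskm tens1_comp tens_comp1 !compA.
rw (brinv_nat (mul A) (idm A)); rw (brinv_nat (idm A) (mul A)).
have M : mul A ∘ (mul A ▷ A) = mul A ∘ (idm A ⊠ mul A) ∘ assoc A A A by apply: mulA.
rw M; congr (_ ∘ _ ∘ _).
rw (brinv_nat (idm A) (brinv A A)).
have E1 := f_equal (comp (associ A A A)) (bar_hexagon1 A A A).
move: E1; rw (assocK A A A); rewrite comp1m => ->.
have E2 := f_equal (fun x => assoc A A A ∘ x ∘ assoc A A A) (bar_hexagon2 A A A).
move: E2; rewrite !compA; rw (associK A A A); rewrite comp1m assocK compm1 => ->.
by rewrite !compA.
Qed.

(* The semigroup (A, m.c^-1), seen in the category with the inverse braiding. *)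
Definition rev_semigroup (C : braided_category) (A : semigroup C) :
  semigroup (bar C) := @Semigroup (bar C) A (mul A ∘ brinv A A) (rev_mulA A).

Section Bimonoids.
Variables (C : braided_category) (A : C).
Implicit Types t : hom (A ⊗ A) (A ⊗ A).

Definition fusion t : Prop :=
  (A ◁ t) ∘ (t ▷ A)
  = (t ▷ A) ∘ (brinv A A ▷ A) ∘ (A ◁ t) ∘ (br A A ▷ A) ∘ (A ◁ t).

(* Fusion morphisms in the category with the reversed monoidal product. *)
Definition fusion_rev t : Prop :=
  (t ▷ A) ∘ (A ◁ t)
  = (A ◁ t) ∘ (A ◁ brinv A A) ∘ (t ▷ A) ∘ (A ◁ br A A) ∘ (t ▷ A).

Definition counit t (e : hom A 𝟙) : Prop :=
  (idm A ⊠ e) ∘ t = idm A ⊠ e.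

Definition counit_rev t (e : hom A 𝟙) : Prop :=
  (e ⊠ idm A) ∘ t = e ⊠ idm A.

Definition multiplier_bimonoid t1 t2 (e : hom A 𝟙) : Prop :=
  [/\ fusion t1 /\ fusion_rev t2,
      counit t1 e /\ counit_rev t2 e,
      (A ◁ t1) ∘ (t2 ▷ A) = (t2 ▷ A) ∘ (A ◁ t1)
    & runit A ∘ (idm A ⊠ e) ∘ t2 = lunit A ∘ (e ⊠ idm A) ∘ t1].

End Bimonoids.

Section RegularBimonoids.
Variables (C : braided_category) (A : C).

Definition regular_axiom (t1 t2 t3 t4 : hom (A ⊗ A) (A ⊗ A)) (e : hom A 𝟙) : Prop :=
  let m := lunit A ∘ (e ⊠ idm A) ∘ t1 in
  [/\ multiplier_bimonoid t1 t2 e /\ @multiplier_bimonoid (bar C) A t3 t4 e,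
      m = lunit A ∘ (e ⊠ idm A) ∘ t3 ∘ br A A,
      (A ◂ m) ∘ (br A A ▷ A) ∘ (A ◁ t1)
        = (A ◂ m) ∘ (t3 ▷ A) ∘ (br A A ▷ A) /\
      (t4 ▷ A) ∘ (A ◁ t1) = (A ◁ t1) ∘ (t4 ▷ A),
      (m ▷ A) ∘ (A ◁ br A A) ∘ (t2 ▷ A)
        = (m ▷ A) ∘ (A ◁ t4) ∘ (A ◁ br A A)
    & (A ◁ t3) ∘ (t2 ▷ A) = (t2 ▷ A) ∘ (A ◁ t3)].

End RegularBimonoids.

Record regular_multiplier_bimonoid (C : braided_category) :=
  RegularMultiplierBimonoid {
  rmb_ob : C;
  rmb_t1 : hom (rmb_ob ⊗ rmb_ob) (rmb_ob ⊗ rmb_ob);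
  rmb_t2 : hom (rmb_ob ⊗ rmb_ob) (rmb_ob ⊗ rmb_ob);
  rmb_t3 : hom (rmb_ob ⊗ rmb_ob) (rmb_ob ⊗ rmb_ob);
  rmb_t4 : hom (rmb_ob ⊗ rmb_ob) (rmb_ob ⊗ rmb_ob);
  rmb_e : hom rmb_ob 𝟙;
  rmbP : regular_axiom rmb_t1 rmb_t2 rmb_t3 rmb_t4 rmb_e
}.

Section Simplices12.
Variable C : braided_category.

Section Dim2.
Variables A12 A02 A01 : semigroup C.
Implicit Types (φ : hom (A02 ⊗ A12) (A01 ⊗ A12))
               (ψ : hom (A01 ⊗ A02) (A01 ⊗ A12)).

Definition M1_simplex2 φ : Prop :=
  φ ∘ (A02 ◂ mul A12) = (A01 ◂ mul A12) ∘ (φ ▷ A12) /\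
  φ ∘ (mul A02 ▷ A12)
  = (mul A01 ▷ A12) ∘ (brinv A01 A01 ▷ A12) ∘ (A01 ◁ φ)
    ∘ (br A02 A01 ▷ A12) ∘ (A02 ◁ φ).

Definition M2_simplex2 ψ : Prop :=
  ψ ∘ (mul A01 ▷ A02) = (mul A01 ▷ A12) ∘ (A01 ◁ ψ) /\
  ψ ∘ (A01 ◂ mul A02)
  = (A01 ◂ mul A12) ∘ (A01 ◁ brinv A12 A12) ∘ (ψ ▷ A12)
    ∘ (A01 ◁ br A12 A02) ∘ (ψ ▷ A02).

Definition M12_simplex2 φ ψ : Prop :=
  [/\ M1_simplex2 φ, M2_simplex2 ψ
    & (mul A01 ▷ A12) ∘ (A01 ◁ φ) = (A01 ◂ mul A12) ∘ (ψ ▷ A12)].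

End Dim2.

Section Dim3.
Variables A01 A02 A03 A12 A13 A23 : C.
Definition M1_filler
    (φ123 : hom (A13 ⊗ A23) (A12 ⊗ A23)) (φ023 : hom (A03 ⊗ A23) (A02 ⊗ A23))
    (φ013 : hom (A03 ⊗ A13) (A01 ⊗ A13)) (φ012 : hom (A02 ⊗ A12) (A01 ⊗ A12)) : Prop :=
  (A01 ◁ φ123) ∘ (φ013 ▷ A23)
  = (φ012 ▷ A23) ∘ (brinv A12 A02 ▷ A23) ∘ (A12 ◁ φ023)
    ∘ (br A03 A12 ▷ A23) ∘ (A03 ◁ φ123).

Definition M2_filler
    (ψ123 : hom (A12 ⊗ A13) (A12 ⊗ A23)) (ψ023 : hom (A02 ⊗ A03) (A02 ⊗ A23))
    (ψ013 : hom (A01 ⊗ A03) (A01 ⊗ A13)) (ψ012 : hom (A01 ⊗ A02) (A01 ⊗ A12)) : Prop :=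
  (ψ012 ▷ A23) ∘ (A01 ◁ ψ023)
  = (A01 ◁ ψ123) ∘ (A01 ◁ brinv A13 A12) ∘ (ψ013 ▷ A12)
    ∘ (A01 ◁ br A12 A03) ∘ (ψ012 ▷ A03).

Definition M12_filler
    (φ123 : hom (A13 ⊗ A23) (A12 ⊗ A23)) (φ023 : hom (A03 ⊗ A23) (A02 ⊗ A23))
    (φ013 : hom (A03 ⊗ A13) (A01 ⊗ A13)) (φ012 : hom (A02 ⊗ A12) (A01 ⊗ A12))
    (ψ123 : hom (A12 ⊗ A13) (A12 ⊗ A23)) (ψ023 : hom (A02 ⊗ A03) (A02 ⊗ A23))
    (ψ013 : hom (A01 ⊗ A03) (A01 ⊗ A13)) (ψ012 : hom (A01 ⊗ A02) (A01 ⊗ A12)) : Prop :=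
  [/\ M1_filler φ123 φ023 φ013 φ012, M2_filler ψ123 ψ023 ψ013 ψ012
    & (ψ012 ▷ A23) ∘ (A01 ◁ φ023) = (A01 ◁ φ123) ∘ (ψ013 ▷ A23)].

End Dim3.
End Simplices12.

(* In the mixed conditions the multiplications are the original ones of [C],
   whereas the [M12] condition over [bar C] uses the reversed ones. *)
Section SimplicesM.
Variable C : braided_category.

Definition M_simplex2 (A12 A02 A01 : semigroup C)
    (φ : hom (A02 ⊗ A12) (A01 ⊗ A12)) (ψ : hom (A01 ⊗ A02) (A01 ⊗ A12))
    (φ' : hom (A02 ⊗ A12) (A01 ⊗ A12)) (ψ' : hom (A01 ⊗ A02) (A01 ⊗ A12)) :
    Prop :=
  [/\ M12_simplex2 φ ψ,
      @M12_simplex2 (bar C)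
        (rev_semigroup A12) (rev_semigroup A02) (rev_semigroup A01) φ' ψ',
      (mul A01 ▷ A12) ∘ (brinv A01 A01 ▷ A12) ∘ (A01 ◁ φ)
        = (A01 ◂ mul A12) ∘ (ψ' ▷ A12) /\
      (A01 ◂ mul A12) ∘ (A01 ◁ brinv A12 A12) ∘ (ψ ▷ A12)
        = (mul A01 ▷ A12) ∘ (A01 ◁ φ'),
      (A01 ◂ mul A12) ∘ (br A12 A01 ▷ A12) ∘ (A12 ◁ φ)
        = (A01 ◂ mul A12) ∘ (φ' ▷ A12) ∘ (br A12 A02 ▷ A12)
    & (mul A01 ▷ A12) ∘ (A01 ◁ br A12 A01) ∘ (ψ ▷ A01)
        = (mul A01 ▷ A12) ∘ (A01 ◁ ψ') ∘ (A01 ◁ br A02 A01)].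

Record M_cell (A12 A02 A01 : semigroup C) := MCell {
  phi : hom (A02 ⊗ A12) (A01 ⊗ A12);
  psi : hom (A01 ⊗ A02) (A01 ⊗ A12);
  phi' : hom (A02 ⊗ A12) (A01 ⊗ A12);
  psi' : hom (A01 ⊗ A02) (A01 ⊗ A12);
  cellP : M_simplex2 phi psi phi' psi'
}.

Record M_simp2 := MSimp2 {
  edge12 : semigroup C;
  edge02 : semigroup C;
  edge01 : semigroup C;
  cell : M_cell edge12 edge02 edge01
}.

Variant M_filler : M_simp2 -> M_simp2 -> M_simp2 -> M_simp2 -> Prop :=
  MFiller (A01 A02 A03 A12 A13 A23 : semigroup C)
    (w123 : M_cell A23 A13 A12) (w023 : M_cell A23 A03 A02)
    (w013 : M_cell A13 A03 A01) (w012 : M_cell A12 A02 A01) of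
    M12_filler (phi w123) (phi w023) (phi w013) (phi w012)
               (psi w123) (psi w023) (psi w013) (psi w012)
  & @M12_filler (bar C) A01 A02 A03 A12 A13 A23
               (phi' w123) (phi' w023) (phi' w013) (phi' w012)
               (psi' w123) (psi' w023) (psi' w013) (psi' w012)
  & (psi' w012 ▷ A23) ∘ (A01 ◁ phi w023)
    = (A01 ◁ phi w123) ∘ (psi' w013 ▷ A23)
  & (A01 ◁ phi' w123) ∘ (psi w013 ▷ A23)
    = (psi w012 ▷ A23) ∘ (A01 ◁ phi' w023) :
  M_filler (MSimp2 w123) (MSimp2 w023) (MSimp2 w013) (MSimp2 w012).

End SimplicesM.

Section Degeneracies12.
Variable C : braided_category.

Lemma M12_s0 (A : semigroup C) u hu : u = lunit 𝟙 ->
  @M12_simplex2 C A A (@Semigroup C 𝟙 u hu)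
    (luniti A ∘ mul A) (idm (𝟙 ⊗ A)).
Proof.
move=> e; move: hu; rewrite e => hu; split; first split => /=.
- by rewrite tens_comp1; rw (unit_lwhiskm (mul A)); rewrite mulA.
- rewrite (@lwhisk_luniti _ A) br_unitr brinv_unit tensm1 comp1m tens_comp1; cA.
  rw (tensl_iso A (runitiK (A : C))); rewrite comp1m.
  rw (unit_lwhisk (luniti A ∘ mul A)).
  rw (tensl_iso A (lunitiK (𝟙 : C))); rewrite comp1m.
  by rewrite mulA.
- split => /=.
    by rewrite comp1m lwhisk1 compm1.
  by rewrite !tensm1 !comp1m !compm1 lwhisk_brK compm1.
rewrite /= lwhisk_luniti lunit_runit1; rw (tensl_iso A (runitiK (𝟙 : C))).
by rewrite comp1m tensm1 compm1.
Qed.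

Lemma M12_s1 (A : semigroup C) u hu : u = lunit 𝟙 ->
  @M12_simplex2 C (@Semigroup C 𝟙 u hu) A A
    (idm (A ⊗ 𝟙)) (runiti A ∘ mul A).
Proof.
move=> e; move: hu; rewrite e => hu; split; first split => /=.
- by rewrite comp1m tensm1 compm1.
- rewrite lwhisk1; c1; rw (tensl_iso 𝟙 (brK (A : C) A)).
  by rewrite compm1.
- split => /=.
    rewrite lwhisk_runiti; rw (esym (runiti_nat (mul A))).
    by rewrite mulA.
  rewrite lwhiskm_lunit brinv_unit lwhisk1 comp1m br_unitl.
  rewrite lwhisk_runiti lwhiskm_lunit (tens_comp1 A); cA.
  rw (tensl_iso A (runitiK (A : C))); rewrite comp1m.
  rw (esym (runiti_nat (runiti A ∘ mul A))).
  rw (esym (runiti_nat (runit A))).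
  by rw (runitiK A); rewrite comp1m mulA.
rewrite /= lwhisk1 compm1 lwhiskm_lunit tens_comp1.
by rw (tensl_iso 𝟙 (runitiK (A : C))); rewrite comp1m.
Qed.

Lemma rev_unit_mul : lunit 𝟙 ∘ brinv 𝟙 𝟙 = lunit 𝟙 :> hom (𝟙 ⊗ 𝟙 : C) 𝟙.
Proof. by rewrite brinv_unit compm1. Qed.

Section Fillers.
Variables (B12 B02 B01 : semigroup C).
Variables (φ : hom (B02 ⊗ B12) (B01 ⊗ B12)) (ψ : hom (B01 ⊗ B02) (B01 ⊗ B12)).
Hypothesis h : M12_simplex2 φ ψ.

Lemma M12_filler_s0 :
  @M12_filler C 𝟙 B01 B02 B01 B02 B12
    φ φ (luniti B02 ∘ mul B02) (luniti B01 ∘ mul B01)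
    ψ ψ (idm _) (idm _).
Proof.
case: h => -[_ h1] _ _; split.
- by rewrite /M1_filler !tens_comp1; cA; rw (unit_lwhisk φ); rewrite h1.
- by rewrite /M2_filler !tensm1; c1; rewrite lwhisk_brK compm1.
by rewrite !tensm1; c1.
Qed.

Lemma M12_filler_s1 :
  @M12_filler C B01 B01 B02 𝟙 B12 B12
    (luniti B12 ∘ mul B12) φ φ (idm _)
    (idm _) ψ ψ (runiti B01 ∘ mul B01).
Proof.
case: h => -[h1 _] [h2 _] h3; split.
- rewrite /M1_filler !lwhisk_luniti tensm1 brinv_unitl br_unitr; c1.
  rewrite !tens_comp1; cA; rewrite -h1.
  rw (tensl_iso B12 (runitiK (B02 : C))); rewrite comp1m.
  rw (unit_lwhisk φ); rw (tensl_iso B12 (lunitiK (B01 : C))).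
  by rewrite comp1m.
- rewrite /M2_filler lwhisk1 comp1m br_unitl brinv_unitr.
  rewrite lwhisk_runiti lwhisk_luniti lwhiskm_lunit lwhiskm_runit.
  rewrite !tens_comp1; cA; rw (tensl_iso B02 (runitiK (B01 : C))); c1.
  rw (esym (runiti_nat ψ)); rw (runitiK (B01 ⊗ B12 : C)); c1.
  by rewrite h2.
rewrite lwhisk_luniti tens_comp1; cA.
by rewrite h3.
Qed.

Lemma M12_filler_s2 :
  @M12_filler C B01 B02 B02 B12 B12 𝟙
    (idm _) (idm _) φ φ
    (runiti B12 ∘ mul B12) (runiti B02 ∘ mul B02) ψ ψ.
Proof.
case: h => _ [_ h2] _; split.
- rewrite /M1_filler !lwhisk1; c1.
  by rewrite (tensl_iso 𝟙 (brK (B02 : C) B12)) compm1.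
- rewrite /M2_filler !lwhisk_runiti; rw (esym (runiti_nat ψ)).
  by rewrite h2.
by rewrite !lwhisk1; c1.
Qed.

End Fillers.
End Degeneracies12.

Section DegeneraciesM.
Variable C : braided_category.

Lemma M_s0P (A : semigroup C) :
  @M_simplex2 C A A (unit_semigroup C)
    (luniti A ∘ mul A) (idm _) (luniti A ∘ mul A ∘ brinv A A) (idm _).
Proof.
split; first exact: M12_s0.
- exact: (@M12_s0 (bar C) (rev_semigroup A) _ _ (rev_unit_mul C)).
- split => /=; rewrite lwhisk_luniti.
    rewrite brinv_unit lunit_runit1 !tensm1; c1.
    by rw (tensl_iso A (runitiK (𝟙 : C))); c1.
  rewrite lunit_runit1; rw (tensl_iso A (runitiK (𝟙 : C))); rewrite tensm1; c1.
  by rewrite lwhiskm_comp.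
- rewrite /= (@lwhisk_luniti _ A) br_unitr !tens_comp1; cA.
  rw (tensl_iso A (runitiK (A : C))); rewrite comp1m.
  do 2 rw (unit_lwhiskm (mul A)); rewrite (tensl_iso A (brK (A : C) A)) compm1.
  by rewrite mulA.
by rewrite /= lwhisk1 tensm1; c1.
Qed.

Lemma M_s1P (A : semigroup C) :
  @M_simplex2 C (unit_semigroup C) A A
    (idm _) (runiti A ∘ mul A) (idm _) (runiti A ∘ mul A ∘ brinv A A).
Proof.
split; first exact: M12_s1.
- exact: (@M12_s1 (bar C) (rev_semigroup A) _ _ (rev_unit_mul C)).
- split => /=; rewrite lwhisk1 lwhiskm_lunit !tens_comp1; c1.
    by rw (tensl_iso 𝟙 (runitiK (A : C))); c1.
  rewrite brinv_unit lwhisk1 comp1m.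
  by rw (tensl_iso 𝟙 (runitiK (A : C))); c1.
- by rewrite /= lwhisk1 tensm1; c1.
rewrite /= br_unitl !lwhisk_runiti lwhiskm_lunit tens_comp1; cA.
rw (tensl_iso A (runitiK (A : C))); c1.
do 2 rw (esym (runiti_nat (mul A))); rewrite lwhiskm_comp; cA.
by rewrite lwhisk_brK compm1 mulA.
Qed.

Definition M_s0 (A : semigroup C) : M_simp2 C := MSimp2 (MCell (M_s0P A)).
Definition M_s1 (A : semigroup C) : M_simp2 C := MSimp2 (MCell (M_s1P A)).

Lemma MCell_eq (A12 A02 A01 : semigroup C) (u v : M_cell A12 A02 A01) :
  phi u = phi v -> psi u = psi v -> phi' u = phi' v -> psi' u = psi' v -> u = v.
Proof.
case: u v => [p q r s h] [p' q' r' s' h'] /= ? ? ? ?; subst.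
by rewrite (proof_irrelevance _ h h').
Qed.

Lemma M_s0s0 : M_s0 (unit_semigroup C) = M_s1 (unit_semigroup C).
Proof.
congr MSimp2; apply: MCell_eq => /=.
- by rewrite lunitK.
- by rewrite lunit_runit1 runitK.
- by rewrite brinv_unit compm1 lunitK.
by rewrite brinv_unit compm1 lunit_runit1 runitK.
Qed.

Definition M_face1 (i : 'I_3) (w : M_simp2 C) : semigroup C :=
  match nat_of_ord i with 0 => edge12 w | 1 => edge02 w | _ => edge01 w end.

Definition M_degen1 (j : 'I_2) (A : semigroup C) : M_simp2 C :=
  match nat_of_ord j with 0 => M_s0 A | _ => M_s1 A end.

Lemma M_filler_s0 w : M_filler w w (M_s0 (edge02 w)) (M_s0 (edge01 w)).
Proof.
case: w => B12 B02 B01 w /=; case: (cellP w) => h1 h2 h3 h4 h5.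
apply: MFiller => /=.
- exact: (M12_filler_s0 h1).
- exact: (M12_filler_s0 h2).
- by rewrite !tensm1; c1.
by rewrite !tensm1; c1.
Qed.

Lemma M_filler_s1 w : M_filler (M_s0 (edge12 w)) w w (M_s1 (edge01 w)).
Proof.
case: w => B12 B02 B01 w /=; case: (cellP w) => h1 h2 [h3 h3'] h4 h5.
apply: MFiller => /=.
- exact: (M12_filler_s1 h1).
- exact: (M12_filler_s1 h2).
- by rewrite lwhisk_luniti !tens_comp1; cA; rewrite h3.
by rewrite lwhisk_luniti lwhiskm_comp !tens_comp1; cA; rewrite h3'.
Qed.

Lemma M_filler_s2 w : M_filler (M_s1 (edge12 w)) (M_s1 (edge02 w)) w w.
Proof.
case: w => B12 B02 B01 w /=; case: (cellP w) => h1 h2 h3 h4 h5.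
apply: MFiller => /=.
- exact: (M12_filler_s2 h1).
- exact: (M12_filler_s2 h2).
- by rewrite !lwhisk1; c1.
by rewrite !lwhisk1; c1.
Qed.

Definition M_base : tier 0.
Proof.
refine (@Tier 0 unit (semigroup C) (M_simp2 C) (fun _ _ => tt) M_face1
  (fun _ _ => unit_semigroup C) M_degen1 _ _ _ _ _).
- by [].
- move=> A i j h; have [-> ->] : i = 0 /\ j = 1 by lia.
  by rewrite /M_face1 /M_degen1 !inordK.
- move=> A i [|[|j]] // _ [->|->];
  by rewrite /M_face1 /M_degen1 !inordK.
- move=> A i j h; have [-> ->] : i = 2 /\ j = 0 by lia.
  by rewrite /M_face1 /M_degen1 !inordK.
move=> A i j h; have [-> ->] : i = 0 /\ j = 0 by lia.
by rewrite /M_degen1 !inordK //= M_s0s0.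
Defined.

Definition M_fill (w : 'I_4 -> M_simp2 C) : Prop :=
  M_filler (w (inord 0)) (w (inord 1)) (w (inord 2)) (w (inord 3)).

Lemma M_fillP j x : @M_fill (@degen_boundary 0 M_base j x).
Proof.
have [m [hm ->]] : exists m, m < 3 /\ j = inord m.
  by exists j; rewrite inord_val.
rewrite /M_fill /degen_boundary.
move: m hm => [|[|[|m]]] // _; rewrite !inordK //=;
  rewrite /M_face1 /M_degen1 !inordK //=.
- exact: M_filler_s0.
- exact: M_filler_s1.
exact: M_filler_s2.
Qed.

Definition M_sset : sset := @gen_sset M_base M_fill M_fillP (fun x _ _ _ _ => let: tt := x in erefl).

End DegeneraciesM.

(* Main.v *)
Require Import Defs.
From mathcomp Require Import all_boot.
From Stdlib Require Import FunctionalExtensionality ProofIrrelevance.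

Import Defs.

(** A simplicial map out of the Catalan simplicial set is known once it is
    known in dimensions at most 2: both sides are coskeletal above, so a family
    of maps in those dimensions that commutes with faces and degeneracies
    extends uniquely as soon as it sends 3-simplices to fillable boundaries
    ([gen_sset_map], [sset_map_eq]). The degenerate simplices take care of
    themselves. What is left is a semigroup [A], the image of [alpha], a cell
    [tau] given by four endomorphisms [t1], [t2], [t3], [t4] of [A ⊗ A], a cell
    [epsilon] given by four maps that amount to morphisms from [A] to the unit,
    and one filling condition for each of the four nondegenerate 3-simplices
    ([tau], [tau], [tau], [tau]), ([epsilon], [s1 alpha], [tau], [s1 alpha]),
    ([s0 alpha], [tau], [s0 alpha], [epsilon]) and ([epsilon], [s1 alpha],
    [s0 alpha], [epsilon]). This is the record [catalan_cells].

    Unwinding the four conditions gives the axioms of a regular multiplier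
    bimonoid. The first one consists of the four fusion equations and of the
    commutation of [t1] and [t3] with [t2] and [t4]. The last one makes the four
    parts of [epsilon] the same morphism [e]. The other two say that [e] is a counit for each [t], and they express
    the multiplication as [(e1).t1] and as [(1e).t2], and its reverse as
    [(e1).t3] and as [(1e).t4]; in particular the multiplication is determined
    by the bimonoid ([rmb_cellsP]). The two axioms that link [t1] to [t3] and
    [t2] to [t4] through the multiplication and the braiding are conditions on
    the cell [tau] itself.

    Conversely the other conditions on [tau] and [epsilon] follow from the
    bimonoid axioms by applying [e] to tensor factors. On the fusion equation
    for [t1], applying [e] to the first factor gives the compatibility
    of [t1] with multiplication on the left ([fusion_mull]), and applying it to
    the middle factor gives the compatibility on the right ([fusion_mulr]);
    associativity of the multiplication follows ([fusion_mulA]). The equations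
    relating [t1], [t3] to [t2], [t4] come from the commutation equations by
    applying [e] in the middle ([commute_mul]), and [epsilon] is a cell because
    the counit property makes [e] multiplicative ([counit_mul]). The conditions on [t3], [t4]
    are those on [t1], [t2] in the category with inverse braiding, so each
    argument is carried out once, for an arbitrary braiding. *)

Set Implicit Arguments.
Unset Strict Implicit.
Unset Printing Implicit Defensive.
Local Open Scope cat_scope.

(** * Simplicial maps between coskeletal simplicial sets *)

Record tier_map n (T T' : tier n) := TierMap {
  map_lo : lo T -> lo T';
  map_mid : mid T -> mid T';
  map_top : top T -> top T';
  map_dlo : forall i x, map_lo (dlo i x) = dlo i (map_mid x);
  map_dtop : forall i x, map_mid (dtop i x) = dtop i (map_top x);
  map_slo : forall i x, map_mid (slo i x) = slo i (map_lo x);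
  map_stop : forall i x, map_top (stop i x) = stop i (map_mid x)
}.

(** A map of three consecutive levels extends to the next level whenever it
    preserves the filling condition: fillers are boundaries, so they are mapped
    face by face. *)
Section StepMap.
Variables (n : nat) (T T' : tier n) (F : tier_map T T').
Variables (P : ('I_n.+4 -> top T) -> Prop) (P' : ('I_n.+4 -> top T') -> Prop).
Hypothesis HP : forall j x, P (degen_boundary j x).
Hypothesis HP' : forall j x, P' (degen_boundary j x).
Hypothesis PF : forall u : filled P, P' (map_top F \o u).

Lemma map_boundary (w : 'I_n.+4 -> top T) :
  boundary w -> boundary (map_top F \o w).
Proof. by move=> b i j h /=; rewrite -!map_dtop b. Qed.

Definition map_filled (u : filled P) : filled P' :=
  Filled (map_boundary (fill_boundary u)) (PF u).

Lemma map_fdegen j (x : top T) :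
  map_filled (fdegen HP j x) = fdegen HP' j (map_top F x).
Proof.
apply: filled_eq => i _ /=; rewrite /degen_boundary.
by case: ifP => _; [|case: ifP => _]; rewrite ?map_stop ?map_dtop.
Qed.

Definition step_map : tier_map (step HP) (step HP') :=
  @TierMap _ (step HP) (step HP') (map_mid F) (map_top F) map_filled
    (@map_dtop _ _ _ F) (fun _ _ => erefl) (@map_stop _ _ _ F) map_fdegen.

End StepMap.

Section TowerMap.
Variables (T T' : tier 0) (F : tier_map T T').
Variables (P : ('I_4 -> top T) -> Prop) (P' : ('I_4 -> top T') -> Prop).
Hypothesis HP : forall j x, P (degen_boundary j x).
Hypothesis HP' : forall j x, P' (degen_boundary j x).
Hypothesis Heq : forall (x : lo T) i j, j < 1 -> i = j \/ i = j.+1 ->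
  dlo (inord i) (slo (inord j) x) = x.
Hypothesis Heq' : forall (x : lo T') i j, j < 1 -> i = j \/ i = j.+1 ->
  dlo (inord i) (slo (inord j) x) = x.

Let X := gen_sset HP Heq.
Let Y := gen_sset HP' Heq'.

Section Extend.
Hypothesis PF : forall u : filled P, P' (map_top F \o u).

Fixpoint tower_map k : tier_map (tower HP k) (tower HP' k) :=
  match k with
  | 0 => step_map HP HP' PF
  | k'.+1 => @step_map _ _ _ (tower_map k') (fun _ => True) (fun _ => True)
               (fun _ _ => I) (fun _ _ => I) (fun _ => I)
  end.

Definition gen_map n : simp X n -> simp Y n :=
  match n with
  | 0 => map_lo F
  | 1 => map_mid F
  | 2 => map_top F
  | k.+3 => map_top (tower_map k)
  end.

Lemma gen_map_face n (i : 'I_n.+2) (x : simp X n.+1) :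
  gen_map (face i x) = face i (gen_map x).
Proof.
case: n i x => [|[|[|n]]] i x //.
- exact: map_dlo.
exact: map_dtop.
Qed.

Lemma gen_map_degen n (i : 'I_n.+1) (x : simp X n) :
  gen_map (degen i x) = degen i (gen_map x).
Proof.
case: n i x => [|[|[|n]]] i x.
- exact: map_slo.
- exact: map_stop.
- exact: (map_stop (tower_map 0)).
exact: (map_stop (tower_map n.+1)).
Qed.

Definition gen_sset_map : sset_map X Y := SSetMap gen_map_face gen_map_degen.

End Extend.

Lemma gen_simp_eq n (u v : simp Y n.+3) :
  (forall i, face i u = face i v) -> u = v.
Proof.
by case: n u v => [|n] u v e; apply: filled_eq => i _; exact: (e (inord i)).
Qed.

(** A simplex of dimension at least 3 is the family of its faces, so agreement
    propagates upwards by induction on the dimension. *)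
Lemma sset_map_eq (s t : sset_map X Y) : s 0 =1 t 0 -> s 1 =1 t 1 ->
  s 2 =1 t 2 -> s = t.
Proof.
move=> e0 e1 e2.
have e n : s n =1 t n.
  case: n => [|[|n]] //; elim: n => [|n IH] // x.
  by apply: gen_simp_eq => i; rewrite -!smap_face IH.
have {e} : smap s = smap t.
  by apply: functional_extensionality_dep => n;
     apply: functional_extensionality => x; apply: e.
case: s t {e0 e1 e2} => [s sf sd] [t tf td] /= E; subst t.
by rewrite (proof_irrelevance _ sf tf) (proof_irrelevance _ sd td).
Qed.

End TowerMap.

(** * Simplicial maps out of the Catalan simplicial set *)

Section CatalanMaps.
Variable C : braided_category.

(** The image of the nondegenerate simplices. The last four fields are the
    nondegenerate 3-simplices of the Catalan simplicial set; the field names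
    list their faces, [0] and [1] standing for [s0 alpha] and [s1 alpha]. *)
Record catalan_cells := CatalanCells {
  cc_ob : semigroup C;
  cc_tau : M_cell cc_ob cc_ob cc_ob;
  cc_eps : M_cell (unit_semigroup C) cc_ob (unit_semigroup C);
  cc_tttt : M_filler (MSimp2 cc_tau) (MSimp2 cc_tau)
                     (MSimp2 cc_tau) (MSimp2 cc_tau);
  cc_e1t1 : M_filler (MSimp2 cc_eps) (M_s1 cc_ob) (MSimp2 cc_tau) (M_s1 cc_ob);
  cc_0t0e : M_filler (M_s0 cc_ob) (MSimp2 cc_tau) (M_s0 cc_ob) (MSimp2 cc_eps);
  cc_e10e : M_filler (MSimp2 cc_eps) (M_s1 cc_ob) (M_s0 cc_ob) (MSimp2 cc_eps)
}.

Section MapOfCells.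
Variable D : catalan_cells.

Definition cells_mid (a : catalan1) : semigroup C :=
  if a is Cat_alpha then cc_ob D else unit_semigroup C.

Definition cells_top (w : catalan2) : M_simp2 C :=
  match w with
  | Cat_unit2 => M_s0 (unit_semigroup C)
  | Cat_s0_alpha => M_s0 (cc_ob D)
  | Cat_s1_alpha => M_s1 (cc_ob D)
  | Cat_tau => MSimp2 (cc_tau D)
  | Cat_epsilon => MSimp2 (cc_eps D)
  end.

Definition cells_tier_map : tier_map catalan_base (M_base C).
Proof.
refine (@TierMap _ catalan_base (M_base C) id cells_mid cells_top _ _ _ _).
- by [].
- by move=> [[|[|[|i]]] hi] [].
- by [].
by move=> [[|[|i]] hi] [] //=; rewrite /M_degen1 /= M_s0s0.
Defined.

(** A Catalan 2-simplex is determined by its edges, and there are fourteen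
    compatible quadruples of them: four nondegenerate ones, and ten degenerate
    ones that are filled by degeneracies. *)
Lemma cells_fill (w : 'I_4 -> catalan2) :
  @boundary 0 catalan_base w -> M_fill (cells_top \o w).
Proof.
move=> b; rewrite /M_fill /=.
(* The degeneracies [s1] and [s2] of [epsilon] have a face [s1] of the unit,
   which is listed as [s0] of the unit. *)
have eps1 := M_filler_s1 (MSimp2 (cc_eps D)).
have eps2 := M_filler_s2 (MSimp2 (cc_eps D)).
rewrite /= -!M_s0s0 in eps1 eps2.
have b00 := b 0 0 isT; have b01 := b 0 1 isT; have b02 := b 0 2 isT.
have b11 := b 1 1 isT; have b12 := b 1 2 isT; have b22 := b 2 2 isT.
move: b00 b01 b02 b11 b12 b22; rewrite /= /catalan_face1 !inordK //=.
case: (w (inord 0)); case: (w (inord 1)) => //;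
  case: (w (inord 2)) => //; case: (w (inord 3)) => // _ _ _ _ _ _ /=.
all: first
  [ exact: (cc_tttt D) | exact: (cc_e1t1 D) | exact: (cc_0t0e D)
  | exact: (cc_e10e D) | exact: eps1 | exact: eps2
  | exact: (M_filler_s0 (cells_top Cat_tau))
  | exact: (M_filler_s1 (cells_top Cat_tau))
  | exact: (M_filler_s2 (cells_top Cat_tau))
  | exact: (M_filler_s0 (cells_top Cat_epsilon))
  | exact: (M_filler_s0 (cells_top Cat_s0_alpha))
  | exact: (M_filler_s2 (cells_top Cat_s0_alpha))
  | exact: (M_filler_s1 (cells_top Cat_s1_alpha))
  | exact: (M_filler_s0 (cells_top Cat_unit2))].
Qed.

Definition map_of_cells : sset_map catalan_sset (M_sset C) :=
  @gen_sset_map _ _ cells_tier_map _ _ _ _ _ _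
    (fun u => cells_fill (fill_boundary u)).

End MapOfCells.

Definition faces4 (w0 w1 w2 w3 : catalan2) (i : 'I_4) : catalan2 :=
  nth w0 [:: w0; w1; w2; w3] i.

Lemma faces4_boundary w0 w1 w2 w3 :
  let d i := catalan_face1 (inord i) in
  [/\ [/\ d 0 w0 = d 0 w1, d 1 w0 = d 0 w2 & d 2 w0 = d 0 w3],
      d 1 w1 = d 1 w2, d 2 w1 = d 1 w3 & d 2 w2 = d 2 w3] ->
  @boundary 0 catalan_base (faces4 w0 w1 w2 w3).
Proof.
move=> d [[? ? ?] ? ? ?] i j /andP[].
by case: i j => [|[|[|i]]] [|[|[|j]]] // _ _; rewrite /faces4 !inordK.
Qed.

Section CellsOfMap.
Variable s : sset_map catalan_sset (M_sset C).

Lemma smap_unit : s 1 Cat_unit = unit_semigroup C.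
Proof. by have := @smap_degen _ _ s 0 ord0 tt. Qed.

Lemma smap_s0 a : s 2 (catalan_degen1 (inord 0) a) = M_s0 (s 1 a).
Proof.
have := @smap_degen _ _ s 1 (inord 0) a.
by rewrite /= /M_degen1 inordK.
Qed.

Lemma smap_s1 a : s 2 (catalan_degen1 (inord 1) a) = M_s1 (s 1 a).
Proof.
have := @smap_degen _ _ s 1 (inord 1) a.
by rewrite /= /M_degen1 inordK.
Qed.

Lemma smap_edges w :
  [/\ edge12 (s 2 w) = s 1 (catalan_face1 (inord 0) w),
      edge02 (s 2 w) = s 1 (catalan_face1 (inord 1) w)
    & edge01 (s 2 w) = s 1 (catalan_face1 (inord 2) w)].
Proof.
have f0 := @smap_face _ _ s 1 (inord 0) w.
have f1 := @smap_face _ _ s 1 (inord 1) w.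
have f2 := @smap_face _ _ s 1 (inord 2) w.
by rewrite /= /M_face1 !inordK // in f0 f1 f2.
Qed.

Lemma smap_fill4 w0 w1 w2 w3 :
  @boundary 0 catalan_base (faces4 w0 w1 w2 w3) ->
  M_filler (s 2 w0) (s 2 w1) (s 2 w2) (s 2 w3).
Proof.
move=> b; pose u : simp catalan_sset 3 := Filled b I.
have E i : s 3 u i = s 2 (faces4 w0 w1 w2 w3 i) by rewrite (@smap_face _ _ s 2 i u).
by have := fill_prop (s 3 u); rewrite /M_fill !E /faces4 !inordK.
Qed.

Lemma M_simp2_cell (w : M_simp2 C) A12 A02 A01 :
  edge12 w = A12 -> edge02 w = A02 -> edge01 w = A01 ->
  {c : M_cell A12 A02 A01 | w = MSimp2 c}.
Proof. by case: w => B12 B02 B01 c /= <- <- <-; exists c. Qed.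

(** The edges of the image of [tau] equal the image of [alpha] but are not
    convertible to it, and similarly for [epsilon]; [M_simp2_cell] retypes the
    two cells. *)
Lemma map_of_cellsP : {D | map_of_cells D = s}.
Proof.
have [t0 t1 t2] := smap_edges Cat_tau.
have [e0 e1 e2] := smap_edges Cat_epsilon.
rewrite /catalan_face1 !inordK //= ?smap_unit in t0 t1 t2 e0 e1 e2.
have [tau Etau] := M_simp2_cell t0 t1 t2.
have [eps Eeps] := M_simp2_cell e0 e1 e2.
have S0 := smap_s0 Cat_alpha; have S1 := smap_s1 Cat_alpha.
rewrite /catalan_degen1 !inordK //= in S0 S1.
have F w0 w1 w2 w3 := fun h => smap_fill4 (@faces4_boundary w0 w1 w2 w3 h).
have f1 := F Cat_tau Cat_tau Cat_tau Cat_tau.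
have f2 := F Cat_epsilon Cat_s1_alpha Cat_tau Cat_s1_alpha.
have f3 := F Cat_s0_alpha Cat_tau Cat_s0_alpha Cat_epsilon.
have f4 := F Cat_epsilon Cat_s1_alpha Cat_s0_alpha Cat_epsilon.
rewrite /catalan_face1 !inordK //= Etau Eeps S0 S1 in f1 f2 f3 f4.
have {}f1 := f1 (And4 (And3 erefl erefl erefl) erefl erefl erefl).
have {}f2 := f2 (And4 (And3 erefl erefl erefl) erefl erefl erefl).
have {}f3 := f3 (And4 (And3 erefl erefl erefl) erefl erefl erefl).
have {}f4 := f4 (And4 (And3 erefl erefl erefl) erefl erefl erefl).
exists (CatalanCells f1 f2 f3 f4).
apply: sset_map_eq => [x|a|w].
- by case: x; case: (s 0 tt).
- by case: a => //=; rewrite smap_unit.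
case: w => /=; rewrite ?S0 ?S1 ?Etau ?Eeps //.
by have := smap_s0 Cat_unit; rewrite smap_unit => <-.
Qed.

End CellsOfMap.

End CatalanMaps.

(** * Applying the counit to a tensor factor *)

Section Whisker.
Variable C : monoidal_category.
Implicit Types X Y A B : C.

Lemma lwhisk_tensl X A A' B (f : hom A A') :
  X ◁ (f ▷ B) = (idm X ⊠ f) ▷ B.
Proof.
by rewrite /lwhisk; rw (associ_nat (idm X) f (idm B)); rewrite ?compA assocK compm1.
Qed.

Lemma lwhisk_tensr X A B B' (f : hom B B') :
  X ◁ (idm A ⊠ f) = idm (X ⊗ A) ⊠ f.
Proof.
rewrite /lwhisk; rw (associ_nat (idm X) (idm A) f).
by rewrite ?compA assocK compm1 tensm1.
Qed.

Lemma lwhisk_unit_inj A B A' B' (f g : hom (A ⊗ B) (A' ⊗ B')) :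
  𝟙 ◁ f = 𝟙 ◁ g -> f = g.
Proof.
move=> h; apply: (comp_isoL (tensl_iso B' (lunitiK A'))).
by rewrite -!unit_lwhisk h.
Qed.

End Whisker.

Section CounitSlot.
Variables (C : braided_category) (A : C) (e : hom A 𝟙).
Implicit Types t : hom (A ⊗ A) (A ⊗ A).

Definition counitL : hom (A ⊗ A) A := lunit A ∘ (e ▷ A).
Definition counitR : hom (A ⊗ A) A := runit A ∘ (idm A ⊠ e).

Lemma counitL_br : counitL ∘ br A A = counitR.
Proof.
rewrite /counitL /counitR compA -br_nat br_unitr; cA.
by rw (lunitiK A); rewrite comp1m.
Qed.

Lemma counitR_br : counitR ∘ br A A = counitL.
Proof.
rewrite /counitL /counitR compA -br_nat br_unitl; cA.
by rw (runitiK A); rewrite comp1m.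
Qed.

Lemma counitL_brinv : counitL ∘ brinv A A = counitR.
Proof. by rewrite -counitR_br compA brinvK compm1. Qed.

Lemma counitR_brinv : counitR ∘ brinv A A = counitL.
Proof. by rewrite -counitL_br compA brinvK compm1. Qed.

(** The two ways of applying [e] to the middle factor of a threefold product;
    by the triangle axiom, [e] acts there both on morphisms of the first two
    factors and on morphisms of the last two. *)
Lemma counit_middle : A ◂ counitL = counitR ▷ A.
Proof.
rewrite /counitL lwhiskm_comp lwhiskm_lunit lwhisk_tensl.
by rewrite -tens_comp1.
Qed.

Lemma counitL_lwhisk t : (counitL ▷ A) ∘ (A ◁ t) = t ∘ (counitL ▷ A).
Proof.
rewrite /counitL tens_comp1; cA; rewrite -lwhisk_natl unit_lwhisk'; cA.
by rw (tensl_iso A (lunitiK A)); rewrite comp1m.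
Qed.

Lemma counitL_lwhiskm (m : hom (A ⊗ A) A) :
  counitL ∘ (A ◂ m) = m ∘ (counitL ▷ A).
Proof.
rewrite /counitL tens_comp1; cA; rewrite -lwhiskm_natl unit_lwhiskm'; cA.
by rw (lunitiK A); rewrite comp1m.
Qed.

Lemma counitR_rwhisk t : (A ◂ counitR) ∘ (t ▷ A) = t ∘ (A ◂ counitR).
Proof.
rewrite /counitR lwhiskm_comp lwhiskm_runit lwhisk_tensr; cA.
by rewrite tens_x; rw (runit_nat t).
Qed.

Section Fusion.
Variable t : hom (A ⊗ A) (A ⊗ A).
Let m := counitL ∘ t.
Hypothesis t_fusion : fusion t.
Hypothesis t_counit : counit t e.

Lemma counitR_absorb : counitR ∘ t = counitR.
Proof. by rewrite /counitR compA t_counit. Qed.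

(** Apply [e] to the middle factor of the fusion equation: the counit property
    removes one occurrence of [t], and the braidings move [e] from the middle
    to the first factor and back. *)
Lemma fusion_mulr : t ∘ (A ◂ m) = (A ◂ m) ∘ (t ▷ A).
Proof.
rewrite /m lwhiskm_comp compA t_fusion counit_middle; cA.
have E := tens_comp1 A counitR t; rewrite counitR_absorb in E.
rw (esym E); have {}E := tens_comp1 A counitR (brinv A A).
rewrite counitR_brinv in E; rw (esym E); rw (counitL_lwhisk t).
by have {}E := tens_comp1 A counitL (br A A); rewrite counitL_br in E; rw (esym E).
Qed.

(** Apply [e] to the first factor of the fusion equation. *)
Lemma fusion_mull :
  t ∘ (m ▷ A)
  = (m ▷ A) ∘ (brinv A A ▷ A) ∘ (A ◁ t) ∘ (br A A ▷ A) ∘ (A ◁ t).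
Proof.
rewrite /m tens_comp1; cA; rewrite -t_fusion; rw (counitL_lwhisk t).
by [].
Qed.

(** Apply [e] to the first factor of [fusion_mulr]. *)
Lemma fusion_mulA : m ∘ (m ▷ A) = m ∘ (A ◂ m).
Proof.
rewrite {3}/m compA fusion_mulr; rw (counitL_lwhiskm m).
by rewrite /m !tens_comp1 !compA.
Qed.

(** Since [m] is [(e1).t], the left-hand side is [(ee).t], and the counit
    property removes [t]. *)
Lemma counit_mul : e ∘ m = lunit 𝟙 ∘ (e ⊠ e).
Proof.
rewrite /m /counitL; cA; rw (esym (lunit_nat e)); rw (tens_xr e e).
by rewrite -(tens_xl e e) compA t_counit.
Qed.

End Fusion.

(** The mirror images of the preceding lemmas; [e] is now applied to the middle
    and to the last factor. *)
Section FusionRev.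
Variable t : hom (A ⊗ A) (A ⊗ A).
Let m := counitR ∘ t.
Hypothesis t_fusion : fusion_rev t.
Hypothesis t_counit : counit_rev t e.

Lemma counitL_absorb : counitL ∘ t = counitL.
Proof. by rewrite /counitL compA t_counit. Qed.

Lemma fusion_rev_mull : t ∘ (m ▷ A) = (m ▷ A) ∘ (A ◁ t).
Proof.
rewrite /m tens_comp1 compA t_fusion -counit_middle.
rw (esym (lwhiskm_comp A counitL t)); rewrite counitL_absorb.
rw (esym (lwhiskm_comp A counitL (brinv A A))); rewrite counitL_brinv.
rw (counitR_rwhisk t).
by rw (esym (lwhiskm_comp A counitR (br A A))); rewrite counitR_br.
Qed.

Lemma fusion_rev_mulr :
  t ∘ (A ◂ m)
  = (A ◂ m) ∘ (A ◁ brinv A A) ∘ (t ▷ A) ∘ (A ◁ br A A) ∘ (t ▷ A).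
Proof.
rewrite /m lwhiskm_comp; cA; rewrite -t_fusion; rw (counitR_rwhisk t).
by [].
Qed.

End FusionRev.

(** Apply [e] to the middle factor of a commutation equation. It is stated for
    four morphisms because it serves all pairs among [t1], [t3] and [t2],
    [t4]. *)
Lemma commute_mul (p q r s : hom (A ⊗ A) (A ⊗ A)) :
  (q ▷ A) ∘ (A ◁ p) = (A ◁ r) ∘ (s ▷ A) ->
  ((counitR ∘ q) ▷ A) ∘ (A ◁ p) = (A ◂ (counitL ∘ r)) ∘ (s ▷ A).
Proof.
move=> h; rewrite (tens_comp1 A counitR q) (lwhiskm_comp A counitL r).
by rewrite counit_middle; cA; rewrite h.
Qed.

End CounitSlot.

(** * The cell and the fillers given by the counit *)

Section UnitCell.
Variables (C : braided_category) (A : semigroup C) (e : hom A 𝟙).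
(* The multiplication [u] of the unit semigroup is kept abstract, because it
   becomes [lunit 𝟙] precomposed with a braiding in the reversed semigroup. *)
Variables (u : hom (𝟙 ⊗ 𝟙 : C) 𝟙) (hu : u ∘ (u ▷ 𝟙) = u ∘ (𝟙 ◂ u)).
Hypothesis u1 : u = lunit 𝟙.
Hypothesis e_mul : e ∘ mul A = lunit 𝟙 ∘ (e ⊠ e).

Lemma M12_eps : @M12_simplex2 C (@Semigroup C 𝟙 u hu) A (@Semigroup C 𝟙 u hu)
  (e ▷ 𝟙) (idm 𝟙 ⊠ e).
Proof.
move: hu; rewrite u1 => hu'; split; [split|split|] => /=.
- by rewrite -lwhiskm_natl.
- rewrite brinv_unit !lwhisk_tensl tensm1 comp1m -!tens_comp1.
  rw (esym (br_nat e (idm 𝟙))); rewrite br_unit comp1m (tens_xl e e).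
  by rewrite e_mul.
- by rewrite lwhisk_tensr tens_x.
- rewrite -!lwhisk_tensl; rw (esym (lwhisk_comp 𝟙 (e ▷ 𝟙) (br 𝟙 A))).
  rewrite -(br_nat (idm 𝟙) e) br_unit brinv_unit lwhisk1 comp1m comp1m.
  rw (esym (lwhisk_comp 𝟙 (idm 𝟙 ⊠ e) (e ▷ A))); rewrite tens_xr.
  by rewrite -lwhiskm_comp -e_mul /lwhiskm tens1_comp; cA.
by rewrite lwhisk_tensl lwhiskm_lunit lunit_runit1.
Qed.

End UnitCell.

Lemma M_eps (C : braided_category) (A : semigroup C) (e : hom A 𝟙) :
  e ∘ mul A = lunit 𝟙 ∘ (e ⊠ e) ->
  @M_simplex2 C (unit_semigroup C) A (unit_semigroup C)
    (e ▷ 𝟙) (idm 𝟙 ⊠ e) (e ▷ 𝟙) (idm 𝟙 ⊠ e).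
Proof.
move=> e_mul; split.
- exact: M12_eps.
- apply: (@M12_eps (bar C) (rev_semigroup A)); first exact: (rev_unit_mul C).
  rewrite /= -compA e_mul compA -(brinv_nat e e); cA.
  by rw (rev_unit_mul C).
- have E : (lunit 𝟙 ▷ 𝟙) ∘ (𝟙 ◁ (e ▷ 𝟙)) = (𝟙 ◂ lunit 𝟙) ∘ ((idm 𝟙 ⊠ e) ▷ 𝟙).
    by rewrite lwhisk_tensl lwhiskm_lunit lunit_runit1.
  by rewrite /= brinv_unit tensm1 lwhisk1; c1; rewrite E.
- rewrite /= lwhisk_tensl; cA; rw (esym (tens_comp1 𝟙 (e ▷ 𝟙) (br 𝟙 A))).
  by rewrite -(br_nat (idm 𝟙) e) tens_comp1.
rewrite /= -lwhisk_tensl.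
rw (esym (lwhisk_comp 𝟙 (idm 𝟙 ⊠ e) (br A 𝟙))).
by rewrite -(br_nat e (idm 𝟙)) lwhisk_comp.
Qed.

(** The filling conditions of the three nondegenerate 3-simplices that have
    [epsilon] as a face. The [_mixed] lemmas isolate the condition that relates
    a [φ] to a [ψ]: it has the same form within one braiding and between the
    two, so [m] stands for the multiplication or for its reverse. *)
Section EpsFillers.
Variables (C : braided_category) (A : semigroup C) (e : hom A 𝟙).

Lemma e1t1_mixed (m : hom (A ⊗ A) A) (t : hom (A ⊗ A) (A ⊗ A)) :
  runiti A ∘ m = (idm A ⊠ e) ∘ t ->
  ((runiti A ∘ m) ▷ 𝟙) ∘ (A ◁ idm (A ⊗ 𝟙)) = (A ◁ (e ▷ 𝟙)) ∘ (t ▷ 𝟙).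
Proof. by move=> h; rewrite lwhisk1 compm1 h lwhisk_tensl tens_comp1. Qed.

Lemma t0e_mixed (m : hom (A ⊗ A) A) (t : hom (A ⊗ A) (A ⊗ A)) :
  luniti A ∘ m = (e ▷ A) ∘ t ->
  ((idm 𝟙 ⊠ e) ▷ A) ∘ (𝟙 ◁ t) = (𝟙 ◁ (luniti A ∘ m)) ∘ (idm (𝟙 ⊗ A) ▷ A).
Proof. by move=> h; rewrite tensm1 compm1 h -lwhisk_tensl lwhisk_comp. Qed.

Lemma e10e_mixed :
  ((idm 𝟙 ⊠ e) ▷ 𝟙) ∘ (𝟙 ◁ idm (A ⊗ 𝟙))
  = (𝟙 ◁ (e ▷ 𝟙)) ∘ (idm (𝟙 ⊗ A) ▷ 𝟙).
Proof. by rewrite lwhisk1 tensm1 lwhisk_tensl; c1. Qed.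

Variables t1 t2 : hom (A ⊗ A) (A ⊗ A).

Lemma M12_filler_e1t1 :
  counit t1 e -> runiti A ∘ mul A = (idm A ⊠ e) ∘ t2 ->
  @M12_filler C A A A 𝟙 A 𝟙 (e ▷ 𝟙) (idm _) t1 (idm _)
    (idm 𝟙 ⊠ e) (runiti A ∘ mul A) t2 (runiti A ∘ mul A).
Proof.
move=> ct h2; split; last exact: e1t1_mixed.
- rewrite /M1_filler lwhisk1 tensm1; c1.
  rw (tensl_iso 𝟙 (brK (A : C) 𝟙)); c1.
  by rewrite lwhisk_tensl -tens_comp1 ct.
rewrite /M2_filler br_unitl brinv_unitr !lwhisk_runiti lwhisk_luniti.
rewrite lwhiskm_runit lwhiskm_lunit lwhisk_tensr !tens_comp1; cA.
rw (tensl_iso A (runitiK (A : C))); c1.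
rw (esym (runiti_nat t2)); rw (runitiK (A ⊗ A : C)); c1.
rw (tens_x e (runiti A)); rw (esym h2); rw (esym (runiti_nat (mul A))).
by rewrite mulA.
Qed.

Lemma M12_filler_0t0e :
  counit_rev t2 e -> luniti A ∘ mul A = (e ▷ A) ∘ t1 ->
  @M12_filler C 𝟙 A A 𝟙 A A
    (luniti A ∘ mul A) t1 (luniti A ∘ mul A) (e ▷ 𝟙)
    (idm _) t2 (idm _) (idm 𝟙 ⊠ e).
Proof.
move=> ct h1; split; last exact: t0e_mixed.
- rewrite /M1_filler (@lwhisk_luniti _ A) br_unitr brinv_unitl !tens_comp1; cA.
  rw (tensl_iso A (runitiK (A : C))); c1.
  rw (unit_lwhisk t1); rw (tensl_iso A (lunitiK (A : C))); c1.
  rw (esym (tens_comp1 A (e ▷ 𝟙) (runiti A))); rewrite -runiti_nat tens_comp1; cA.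
  rw (esym h1); rw (unit_lwhisk (luniti A ∘ mul A)).
  by rewrite luniti_runiti1 mulA.
rewrite /M2_filler !lwhisk1 tensm1; c1.
rw (lwhisk_brK 𝟙 𝟙 (A : C)); c1; rewrite -lwhisk_tensl -lwhisk_comp.
by rewrite ct.
Qed.

Lemma M12_filler_e10e :
  e ∘ mul A = lunit 𝟙 ∘ (e ⊠ e) ->
  @M12_filler C 𝟙 A A 𝟙 A 𝟙
    (e ▷ 𝟙) (idm _) (luniti A ∘ mul A) (e ▷ 𝟙)
    (idm 𝟙 ⊠ e) (runiti A ∘ mul A) (idm _) (idm 𝟙 ⊠ e).
Proof.
move=> e_mul; split; last exact: e10e_mixed.
- rewrite /M1_filler lwhisk1; c1; rw (tensl_iso 𝟙 (brK (A : C) 𝟙)); c1.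
  rewrite !lwhisk_tensl -!tens_comp1 tens_xl; rw (esym (luniti_nat e)).
  by rewrite e_mul; rw (lunitK (𝟙 : C)); c1.
rewrite /M2_filler tensm1; c1; rw (lwhisk_brK 𝟙 𝟙 (A : C)); c1.
rewrite -!lwhisk_tensl -!lwhisk_comp tens_xr; rw (esym (runiti_nat e)).
by rewrite e_mul lunit_runit1; rw (runitK (𝟙 : C)); c1.
Qed.

End EpsFillers.

(** * From regular multiplier bimonoids to cells *)

Section MultiplierBimonoid.
Variables (C : braided_category) (A : semigroup C) (e : hom A 𝟙).
Variables t1 t2 : hom (A ⊗ A) (A ⊗ A).
Hypothesis mb : multiplier_bimonoid t1 t2 e.
Hypothesis mE : mul A = lunit A ∘ (e ▷ A) ∘ t1.

Lemma mul_counitL : counitL e ∘ t1 = mul A.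
Proof. by rewrite mE /counitL compA. Qed.

Lemma mul_counitR : counitR e ∘ t2 = mul A.
Proof. by case: mb => _ _ _ h; rewrite mE -h /counitR compA. Qed.

Lemma luniti_mul : luniti A ∘ mul A = (e ▷ A) ∘ t1.
Proof. by rewrite mE; rw (lunitK (A : C)); rewrite comp1m. Qed.

Lemma runiti_mul : runiti A ∘ mul A = (idm A ⊠ e) ∘ t2.
Proof.
by rewrite -mul_counitR /counitR; cA; rw (runitK (A : C)); rewrite comp1m.
Qed.

Lemma mb_counit_mul : e ∘ mul A = lunit 𝟙 ∘ (e ⊠ e).
Proof. by case: mb => _ [h _] _ _; rewrite -mul_counitL counit_mul. Qed.

Lemma mb_M12_simplex2 : M12_simplex2 t1 t2.
Proof.
have h1 := mul_counitL; have h2 := mul_counitR.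
case: mb => -[f1 f2] [c1 c2] comm _; split; [split|split|].
- by rewrite -h1; apply: fusion_mulr.
- by rewrite -h1; apply: fusion_mull.
- by rewrite -h2; apply: fusion_rev_mull.
- by rewrite -h2; apply: fusion_rev_mulr.
by rewrite -{1}h2 -h1; apply: commute_mul; rewrite comm.
Qed.

End MultiplierBimonoid.

Section CellsOfBimonoid.
Variables (C : braided_category) (B : regular_multiplier_bimonoid C).
Let A := rmb_ob B.
Let t1 := rmb_t1 B.
Let t2 := rmb_t2 B.
Let t3 := rmb_t3 B.
Let t4 := rmb_t4 B.
Let e := rmb_e B.

Definition rmb_mul : hom (A ⊗ A) A := lunit A ∘ (e ▷ A) ∘ t1.

Lemma rmb_mulA : rmb_mul ∘ (rmb_mul ▷ A) = rmb_mul ∘ (A ◂ rmb_mul).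
Proof.
case: (rmbP B) => [[[[f _] [c _] _ _] _] _ _ _ _].
by rewrite /rmb_mul -compA; apply: fusion_mulA.
Qed.

Definition rmb_semigroup : semigroup C := Semigroup rmb_mulA.

Let S : semigroup C := rmb_semigroup.

(** This puts [t3] and [t4] in the situation of [t1] and [t2], over the inverse
    braiding. *)
Lemma rmb_rev_mul :
  mul (rev_semigroup S) = lunit A ∘ (e ▷ A) ∘ t3.
Proof.
case: (rmbP B) => _ h _ _ _; rewrite /= /rmb_mul h !compA.
by rewrite brinvK compm1.
Qed.

Lemma rmb_mb : @multiplier_bimonoid C S t1 t2 e.
Proof. by case: (rmbP B) => [[]]. Qed.

Lemma rmb_mb_rev : @multiplier_bimonoid (bar C) (rev_semigroup S) t3 t4 e.
Proof. by case: (rmbP B) => [[]]. Qed.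

Lemma rmb_M_simplex2 : @M_simplex2 C S S S t1 t2 t3 t4.
Proof.
have h1 := mul_counitL (A := S) erefl.
have h2 := mul_counitR rmb_mb erefl.
have h3 : @counitL C S e ∘ t3 = mul S ∘ brinv S S := mul_counitL rmb_rev_mul.
have h4 : @counitR C S e ∘ t4 = mul S ∘ brinv S S :=
  mul_counitR rmb_mb_rev rmb_rev_mul.
case: (rmbP B) => _ _ [a b] c d; split => //.
- exact: mb_M12_simplex2 rmb_mb erefl.
- exact: mb_M12_simplex2 rmb_mb_rev rmb_rev_mul.
split.
  rw (esym (tens_comp1 S (mul S) (brinv S S))); rewrite -{1}h4 -h1.
  by apply: commute_mul; rewrite b.
rw (esym (lwhiskm_comp S (mul S) (brinv S S))); rewrite -h3 -{1}h2.
by symmetry; apply: commute_mul; rewrite d.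
Qed.

Let m1 : luniti S ∘ mul S = (e ▷ S) ∘ t1 := luniti_mul (A := S) erefl.
Let m2 : runiti S ∘ mul S = (idm S ⊠ e) ∘ t2 := runiti_mul (A := S) rmb_mb erefl.
Let m3 : luniti S ∘ mul S ∘ brinv S S = (e ▷ S) ∘ t3 := luniti_mul rmb_rev_mul.
Let m4 : runiti S ∘ mul S ∘ brinv S S = (idm S ⊠ e) ∘ t4 :=
  runiti_mul rmb_mb_rev rmb_rev_mul.

Definition rmb_tau : M_cell S S S := MCell rmb_M_simplex2.
Definition rmb_eps : M_cell (unit_semigroup C) S (unit_semigroup C) :=
  MCell (M_eps (mb_counit_mul rmb_mb (A := S) erefl)).

Lemma rmb_filler_tttt :
  M_filler (MSimp2 rmb_tau) (MSimp2 rmb_tau) (MSimp2 rmb_tau) (MSimp2 rmb_tau).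
Proof.
case: (rmbP B) => -[[[f1 f2] _ h _] [[f3 f4] _ h' _]] _ [_ b] _ d.
by apply: MFiller => //=; split=> //=; rewrite h.
Qed.

Lemma rmb_filler_e1t1 :
  M_filler (MSimp2 rmb_eps) (M_s1 S) (MSimp2 rmb_tau) (M_s1 S).
Proof.
case: (rmbP B) => -[[_ [c1 _] _ _] [_ [c3 _] _ _]] _ _ _ _.
apply: MFiller => /=.
- exact: (@M12_filler_e1t1 C S e t1 t2 c1 m2).
- exact: (@M12_filler_e1t1 (bar C) (rev_semigroup S) e t3 t4 c3 m4).
- exact: (e1t1_mixed m4).
by symmetry; exact: (e1t1_mixed m2).
Qed.

Lemma rmb_filler_0t0e :
  M_filler (M_s0 S) (MSimp2 rmb_tau) (M_s0 S) (MSimp2 rmb_eps).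
Proof.
case: (rmbP B) => -[[_ [_ c2] _ _] [_ [_ c4] _ _]] _ _ _ _.
apply: MFiller => /=.
- exact: (@M12_filler_0t0e C S e t1 t2 c2 m1).
- exact: (@M12_filler_0t0e (bar C) (rev_semigroup S) e t3 t4 c4 m3).
- exact: (t0e_mixed m1).
by symmetry; exact: (t0e_mixed m3).
Qed.

Lemma rmb_filler_e10e :
  M_filler (MSimp2 rmb_eps) (M_s1 S) (M_s0 S) (MSimp2 rmb_eps).
Proof.
apply: MFiller => /=.
- exact: (@M12_filler_e10e C S e (mb_counit_mul rmb_mb (A := S) erefl)).
- exact: (@M12_filler_e10e (bar C) (rev_semigroup S) e
    (mb_counit_mul rmb_mb_rev rmb_rev_mul)).
- exact: (@e10e_mixed C S e).
by symmetry; exact: (@e10e_mixed C S e).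
Qed.

Definition rmb_cells : catalan_cells C :=
  CatalanCells rmb_filler_tttt rmb_filler_e1t1 rmb_filler_0t0e rmb_filler_e10e.

End CellsOfBimonoid.

(** * From cells to regular multiplier bimonoids *)

Section FillerInversion.
Variable C : braided_category.

Lemma MSimp2_inj (A12 A02 A01 : semigroup C) (w w' : M_cell A12 A02 A01) :
  MSimp2 w = MSimp2 w' -> w = w'.
Proof.
move=> E; have := f_equal (fun v : M_simp2 C =>
  existT (fun p => M_cell p.1.1 p.1.2 p.2) (edge12 v, edge02 v, edge01 v) (cell v)) E.
exact: inj_pairT2.
Qed.

Lemma M_fillerE (A01 A02 A03 A12 A13 A23 : semigroup C)
    (w123 : M_cell A23 A13 A12) (w023 : M_cell A23 A03 A02)
    (w013 : M_cell A13 A03 A01) (w012 : M_cell A12 A02 A01) :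
  M_filler (MSimp2 w123) (MSimp2 w023) (MSimp2 w013) (MSimp2 w012) ->
  [/\ M12_filler (phi w123) (phi w023) (phi w013) (phi w012)
               (psi w123) (psi w023) (psi w013) (psi w012),
      @M12_filler (bar C) A01 A02 A03 A12 A13 A23
               (phi' w123) (phi' w023) (phi' w013) (phi' w012)
               (psi' w123) (psi' w023) (psi' w013) (psi' w012),
      (psi' w012 ▷ A23) ∘ (A01 ◁ phi w023)
      = (A01 ◁ phi w123) ∘ (psi' w013 ▷ A23)
    & (A01 ◁ phi' w123) ∘ (psi w013 ▷ A23)
      = (psi w012 ▷ A23) ∘ (A01 ◁ phi' w023)].
Proof.
(* The cells are indexed by their edges, so the equations between 2-simplices
   have to be used on the edges before the cells can be compared. *)
move=> F.
remember (MSimp2 w123) as u123 eqn:E123; remember (MSimp2 w023) as u023 eqn:E023.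
remember (MSimp2 w013) as u013 eqn:E013; remember (MSimp2 w012) as u012 eqn:E012.
case: F E123 E023 E013 E012 => B01 B02 B03 B12 B13 B23 v123 v023 v013 v012.
move=> h1 h2 h3 h4 E123 E023 E013 E012.
have [e23 e13 e12] : [/\ B23 = A23, B13 = A13 & B12 = A12] by case: E123.
have [e03 e02] : B03 = A03 /\ B02 = A02 by case: E023.
have e01 : B01 = A01 by case: E013.
subst.
move: (MSimp2_inj E123) (MSimp2_inj E023) (MSimp2_inj E013) (MSimp2_inj E012).
by move=> ? ? ? ?; subst.
Qed.

End FillerInversion.

Section CounitOfCells.
Variable C : braided_category.

Lemma counit_of_morphism (A : C) (f : hom (A ⊗ 𝟙) (𝟙 ⊗ 𝟙)) :
  {e : hom A 𝟙 | f = e ▷ 𝟙}.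
Proof.
exists (runit 𝟙 ∘ f ∘ runiti A).
by rewrite rwhisk_unit; cA; rw (runitK (𝟙 : C)); rw (runitK A); c1.
Qed.

Lemma eps_morphism_unique (A : C) (e : hom A 𝟙) (f : hom (𝟙 ⊗ A) (𝟙 ⊗ 𝟙)) :
  (f ▷ 𝟙) ∘ (𝟙 ◁ idm (A ⊗ 𝟙)) = (𝟙 ◁ (e ▷ 𝟙)) ∘ (idm (𝟙 ⊗ A) ▷ 𝟙) ->
  f = idm 𝟙 ⊠ e.
Proof.
by rewrite lwhisk1 tensm1 lwhisk_tensl; c1; apply: tens_inj1.
Qed.

(** The hypotheses are three of the mixed conditions for the 3-simplex
    ([epsilon], [s1 alpha], [s0 alpha], [epsilon]); they link [e2] to [e1],
    [e1] to [e4] and [e4] to [e3]. *)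
Lemma eps_morphisms (A : C) (e1 e3 : hom (A ⊗ 𝟙) (𝟙 ⊗ 𝟙))
    (e2 e4 : hom (𝟙 ⊗ A) (𝟙 ⊗ 𝟙)) :
  (e2 ▷ 𝟙) ∘ (𝟙 ◁ idm (A ⊗ 𝟙)) = (𝟙 ◁ e1) ∘ (idm (𝟙 ⊗ A) ▷ 𝟙) ->
  (e4 ▷ 𝟙) ∘ (𝟙 ◁ idm (A ⊗ 𝟙)) = (𝟙 ◁ e1) ∘ (idm (𝟙 ⊗ A) ▷ 𝟙) ->
  (e4 ▷ 𝟙) ∘ (𝟙 ◁ idm (A ⊗ 𝟙)) = (𝟙 ◁ e3) ∘ (idm (𝟙 ⊗ A) ▷ 𝟙) ->
  {e : hom A 𝟙 | [/\ e1 = e ▷ 𝟙, e2 = idm 𝟙 ⊠ e, e3 = e ▷ 𝟙 & e4 = idm 𝟙 ⊠ e]}.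
Proof.
have [e ->] := counit_of_morphism e1; have [e' ->] := counit_of_morphism e3.
move=> /eps_morphism_unique -> /eps_morphism_unique -> h.
have {h} : (idm 𝟙 ⊠ e : hom _ (𝟙 ⊗ 𝟙)) = idm 𝟙 ⊠ e' by exact: eps_morphism_unique.
by move=> /tens1_inj <-; exists e.
Qed.

End CounitOfCells.

Section BimonoidOfFillers.
Variables (C : braided_category) (A : C) (m : hom (A ⊗ A) A) (e : hom A 𝟙).
Variables t1 t2 : hom (A ⊗ A) (A ⊗ A).
Hypothesis tttt : M12_filler t1 t1 t1 t1 t2 t2 t2 t2.
Hypothesis e1t1 : @M12_filler C A A A 𝟙 A 𝟙 (e ▷ 𝟙) (idm _) t1 (idm _)
  (idm 𝟙 ⊠ e) (runiti A ∘ m) t2 (runiti A ∘ m).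
Hypothesis t0e : @M12_filler C 𝟙 A A 𝟙 A A (luniti A ∘ m) t1 (luniti A ∘ m) (e ▷ 𝟙)
  (idm _) t2 (idm _) (idm 𝟙 ⊠ e).

Lemma counit_of_filler : counit t1 e.
Proof.
case: e1t1 => + _ _; rewrite /M1_filler lwhisk1 tensm1; c1.
rw (tensl_iso 𝟙 (brK A 𝟙)); c1; rewrite lwhisk_tensl -tens_comp1.
exact: tens_inj1.
Qed.

Lemma counit_rev_of_filler : counit_rev t2 e.
Proof.
case: t0e => _ + _; rewrite /M2_filler !lwhisk1 tensm1; c1.
rw (lwhisk_brK 𝟙 𝟙 A); c1; rewrite -lwhisk_tensl -lwhisk_comp.
exact: lwhisk_unit_inj.
Qed.

Lemma mul_of_filler1 : m = lunit A ∘ (e ▷ A) ∘ t1.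
Proof.
case: t0e => _ _; rewrite tensm1 -lwhisk_tensl -lwhisk_comp; c1.
by move=> /lwhisk_unit_inj ->; rw (lunitiK A); c1.
Qed.

Lemma mul_of_filler2 : m = runit A ∘ (idm A ⊠ e) ∘ t2.
Proof.
case: e1t1 => _ _; rewrite lwhisk1 lwhisk_tensl -tens_comp1; c1 => /tens_inj1 <-.
by rw (runitiK A); c1.
Qed.

Lemma multiplier_bimonoid_of_fillers : multiplier_bimonoid t1 t2 e.
Proof.
case: tttt => f1 f2 comm; split; [split| split| |] => //.
- exact: counit_of_filler.
- exact: counit_rev_of_filler.
by rewrite -mul_of_filler1 -mul_of_filler2.
Qed.

End BimonoidOfFillers.

(** * The bijection *)

Section Bijection.
Variable C : braided_category.

Lemma rmb_cellsP (D : catalan_cells C) : {B | rmb_cells B = D}.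
Proof.
case: D => -[A m mA] [t1 t2 t3 t4 ht] [e1 e2 e3 e4 he] F1 F2 F3 F4.
have [p1 p2 p3 p4] := M_fillerE F1.
have [q1 q2 _ _] := M_fillerE F2.
have [r1 r2 _ _] := M_fillerE F3.
have [[_ _ s1] [_ _ s2] s3 _] := M_fillerE F4.
have [e [? ? ? ?]] := eps_morphisms s1 s3 s2; simpl in *; subst.
have mb := multiplier_bimonoid_of_fillers p1 q1 r1.
have mb' := multiplier_bimonoid_of_fillers p2 q2 r2.
have mE := mul_of_filler1 r1.
have mE' := mul_of_filler1 r2; simpl in mE'.
have P : regular_axiom t1 t2 t3 t4 e.
  case: (ht) => _ _ _ h h'; rewrite /regular_axiom -mE.
  split => //.
  by rewrite -[m]compm1 -(brK A A) -compA mE' !compA.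
(* The multiplication is forced by [t1] and [e]; once it has been replaced, the
   remaining differences between the two records are proofs. *)
have {}mE : m = @rmb_mul C (RegularMultiplierBimonoid P) by [].
exists (RegularMultiplierBimonoid P); subst m.
have ? : mA = rmb_mulA (RegularMultiplierBimonoid P) by exact: proof_irrelevance.
subst mA.
have ? : ht = rmb_M_simplex2 (RegularMultiplierBimonoid P) by exact: proof_irrelevance.
subst ht.
have ? : he = cellP (rmb_eps (RegularMultiplierBimonoid P)) by exact: proof_irrelevance.
subst he.
by congr CatalanCells; apply: proof_irrelevance.
Qed.

Definition map_of_rmb (B : regular_multiplier_bimonoid C) :
  sset_map catalan_sset (M_sset C) := map_of_cells (rmb_cells B).

(** The preimage is given as data, so that it defines the inverse function
    without an appeal to choice. *)
Lemma map_of_rmbP s : {B | map_of_rmb B = s}.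
Proof.
have [D <-] := map_of_cellsP s; have [B <-] := rmb_cellsP D; by exists B.
Qed.

(** A 2-simplex without its proofs and multiplications: equality of two such
    dependent pairs gives back the equality of morphisms. *)
Definition cell_data (w : M_simp2 C) :=
  let S (p : C * C * C) := hom (p.1.2 ⊗ p.1.1) (p.2 ⊗ p.1.1) in
  let T (p : C * C * C) := hom (p.2 ⊗ p.1.2) (p.2 ⊗ p.1.1) in
  existT (fun p => S p * T p * S p * T p : Type)%type
    (edge12 w : C, edge02 w : C, edge01 w : C)
    (phi (cell w), psi (cell w), phi' (cell w), psi' (cell w)).

Lemma map_of_rmb_inj : injective map_of_rmb.
Proof.
move=> B B' E.
have E' w : cell_data (map_of_rmb B 2 w) = cell_data (map_of_rmb B' 2 w).
  by rewrite E.
move: (E' Cat_tau) (E' Cat_epsilon); clear E E'.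
case: B B' => A t1 t2 t3 t4 e P [A' t1' t2' t3' t4' e' P'] /=.
rewrite /cell_data /= => E1.
have ? : A = A' by case: E1.
subst A'; move=> E2; move: (inj_pairT2 _ _ _ _ _ E1) (inj_pairT2 _ _ _ _ _ E2).
move=> [? ? ? ?] [/tens_inj1 ? _ _ _]; subst.
by rewrite (proof_irrelevance _ P P').
Qed.

End Bijection.

Theorem theorem3p6 (C : braided_category) :
  exists f : sset_map catalan_sset (M_sset C) -> regular_multiplier_bimonoid C,
    bijective f.
Proof.
pose f (s : sset_map catalan_sset (M_sset C)) := sval (map_of_rmbP s).
have fK : cancel f (@map_of_rmb C) by move=> s; exact: svalP (map_of_rmbP s).
by exists f, (@map_of_rmb C) => // B; apply: map_of_rmb_inj; rewrite fK.
Qed.
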